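(* Let $k$ be a field of characteristic zero, $m\le n$ natural numbers, $X$ a smooth affine variety over $k$ with an étale morphism $p:X\to\mathbb A^n$, where $x_1,\dots,x_n$ are the standard coordinates on $\mathbb A^n$, and $D=p^{-1}(V(x_1\cdots x_m))$. Let $M$ be a holonomic $\mathcal D_X$-module, and hence also a (not necessarily finitely generated) $\mathcal D_X^{\log}$-module. Then, as a $\mathcal D_X^{\log}$-module, $M$ is log-holonomic, i.e. for any finitely generated $\mathcal D_X^{\log}$-submodule $M_0\subseteq M$ one has $\dim\mathrm{Car}(M_0)\le n$.
   Context: With $\partial_i=\partial/\partial x_i$ the derivations on $X$ dual to $dx_1,\dots,dx_n$, $\mathcal D_X$ is the ring of differential operators generated by $\mathcal O_X$ and $\partial_1,\dots,\partial_n$, and $\mathcal D_X^{\log}\subset\mathcal D_X$ is the subring generated by $\mathcal O_X$ and $x_1\partial_1,\dots,x_m\partial_m,\partial_{m+1},\dots,\partial_n$. It is filtered by order, with $\mathrm{gr}_\bullet\mathcal D_X^{\log}\simeq\mathrm{Sym}^\bullet_{\mathcal O_X}(\Omega^1_X(\log D)^\vee)$, where $\Omega_X^1(\log D)$ is free on $\frac{dx_1}{x_1},\dots,\frac{dx_m}{x_m},dx_{m+1},\dots,dx_n$. For a finitely generated $\mathcal D_X^{\log}$-module $N$, choose a good filtration (exhaustive, zero in degrees $\ll0$, $\mathcal O_X$-coherent pieces, compatible with the filtration of $\mathcal D^{\log}_X$, $\mathrm{gr}_\bullet N$ finitely generated over $\mathrm{gr}_\bullet\mathcal D_X^{\log}$);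 $\mathrm{Car}(N)$ is the support of $\mathrm{gr}_\bullet N$ in $T^*X^{\log}=\mathrm{Spec}(\mathrm{gr}_\bullet\mathcal D_X^{\log})$ (independent of the filtration). *)

(* Defs.v *)
From HB Require Import structures.
From mathcomp Require Import all_boot all_order all_algebra.
From mathcomp Require Import boolp classical_sets functions.
From mathcomp Require Import mpoly.
From mathcomp Require Import zify.

Set Implicit Arguments.
Unset Strict Implicit.
Unset Printing Implicit Defensive.

Import GRing.Theory.
Local Open Scope ring_scope.

Section AffineMorphisms.
Variables (R S : comNzRingType) (f : {rmorphism R -> S}).

Definition finitely_presented : Prop :=
  exists (r : nat) (g : {rmorphism {mpoly R[r]} -> S}) (s : seq {mpoly R[r]}),
    [/\ forall c, g (mpolyC r c) = f c,
        forall b, exists q, g q = b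
      & forall q, g q = 0 <->
          exists c : 'I_(size s) -> {mpoly R[r]}, q = \sum_i c i * s`_i].

(* [sq_zero_ext pi]: C is the quotient of B by an ideal of square zero. *)
Definition sq_zero_ext (B C : comPzRingType) (pi : {rmorphism B -> C}) : Prop :=
  (forall c, exists b, pi b = c) /\
  (forall a b, pi a = 0 -> pi b = 0 -> a * b = 0).

(* [h'] is a diagonal filler of the square
     R --g--> B
     |f       |pi
     S --h--> C                                                               *)
Definition is_lift (B C : comPzRingType) (pi : {rmorphism B -> C})
    (g : {rmorphism R -> B}) (h : {rmorphism S -> C})
    (h' : {rmorphism S -> B}) : Prop :=
  (forall r, h' (f r) = g r) /\ (forall s, pi (h' s) = h s).

Definition formally_smooth : Prop :=
  forall (B C : comPzRingType) (pi : {rmorphism B -> C})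
         (g : {rmorphism R -> B}) (h : {rmorphism S -> C}),
    sq_zero_ext pi -> (forall r, pi (g r) = h (f r)) ->
    exists h' : {rmorphism S -> B}, is_lift pi g h h'.

Definition formally_unramified : Prop :=
  forall (B C : comPzRingType) (pi : {rmorphism B -> C})
         (g : {rmorphism R -> B}) (h : {rmorphism S -> C})
         (h1 h2 : {rmorphism S -> B}),
    sq_zero_ext pi -> is_lift pi g h h1 -> is_lift pi g h h2 -> h1 =1 h2.

Definition smooth : Prop := finitely_presented /\ formally_smooth.

Definition etale : Prop :=
  [/\ finitely_presented, formally_smooth & formally_unramified].

End AffineMorphisms.

Section LinearEndomorphisms.
Variables (k : comNzRingType) (A : comAlgType k).

Definition klinear : {pred A -> A} := fun f => `[< linear f >].

Record kend := Kend { kend_fun :> A -> A; _ : kend_fun \in klinear }.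

HB.instance Definition _ := [isSub for kend_fun].
HB.instance Definition _ := [Choice of kend by <:].

Fact klinear_zmod_closed : zmod_closed klinear.
Proof.
split=> [|f g /asboolP lf /asboolP lg]; apply/asboolP=> a u v.
  by rewrite /= scaler0 addr0.
have E w : (f - g) w = f w - g w by [].
by rewrite !E lf lg scalerBr addrACA -opprD.
Qed.

HB.instance Definition _ :=
  GRing.isZmodClosed.Build (A -> A) klinear klinear_zmod_closed.
HB.instance Definition _ := [SubChoice_isSubZmodule of kend by <:].

Lemma kendP (P : kend) : linear P.
Proof. exact: (asboolP _ (valP P)). Qed.

Lemma kend_eq (P Q : kend) : P =1 Q -> P = Q.
Proof. by move=> PQ; apply: val_inj; apply: funext. Qed.

Fact kend_one_subproof : (idfun : A -> A) \in klinear.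
Proof. by apply/asboolP. Qed.

Definition kend_one : kend := Kend kend_one_subproof.

Fact kend_mul_subproof (P Q : kend) : (P \o Q) \in klinear.
Proof. by apply/asboolP=> a u v /=; rewrite !kendP. Qed.

Definition kend_mul (P Q : kend) : kend := Kend (kend_mul_subproof P Q).

Lemma kendD (P Q : kend) a : (P + Q) a = P a + Q a. Proof. by []. Qed.

Fact kend_mulA : associative kend_mul. Proof. by move=> P Q S; exact: kend_eq. Qed.
Fact kend_mul1l : left_id kend_one kend_mul. Proof. by move=> P; exact: kend_eq. Qed.
Fact kend_mul1r : right_id kend_one kend_mul. Proof. by move=> P; exact: kend_eq. Qed.
Fact kend_mulDl : left_distributive kend_mul +%R.
Proof. by move=> P Q S; exact: kend_eq. Qed.
Fact kend_mulDr : right_distributive kend_mul +%R.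
Proof.
move=> P Q S; apply: kend_eq => a; change (P (Q a + S a) = P (Q a) + P (S a)).
by rewrite -[Q a]scale1r kendP !scale1r.
Qed.
Fact kend_one_neq0 : kend_one != 0.
Proof.
by apply/eqP=> /(congr1 (fun P : kend => P 1)) /eqP; rewrite (negbTE (oner_neq0 A)).
Qed.

HB.instance Definition _ := GRing.Zmodule_isNzRing.Build kend
  kend_mulA kend_mul1l kend_mul1r kend_mulDl kend_mulDr kend_one_neq0.

Lemma kendM (P Q : kend) a : (P * Q) a = P (Q a). Proof. by []. Qed.

Fact mulop_subproof (a : A) : ( *%R a : A -> A) \in klinear.
Proof. by apply/asboolP=> c u v; rewrite mulrDr scalerAr. Qed.

Definition mulop (a : A) : kend := Kend (mulop_subproof a).

Definition derivation (P : kend) : Prop :=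
  forall a b, P (a * b) = a * P b + P a * b.

End LinearEndomorphisms.

Section GeneratedSubring.
Variables (R : nzRingType) (S : set R).

Definition subring_span : {pred R} := fun r =>
  `[< forall T : {pred R}, GRing.subring_closed T ->
        (forall s, S s -> s \in T) -> r \in T >].

Lemma subring_spanP r : reflect (forall T : {pred R}, GRing.subring_closed T ->
  (forall s, S s -> s \in T) -> r \in T) (r \in subring_span).
Proof. exact: asboolP. Qed.

Fact subring_span_closed : GRing.subring_closed subring_span.
Proof.
split=> [|a b /subring_spanP ha /subring_spanP hb|a b /subring_spanP ha /subring_spanP hb];
  apply/subring_spanP=> T hT ST; have [T1 TB TM] := hT.
- by [].
- by apply: TB; [exact: ha|exact: hb].
- by apply: TM; [exact: ha|exact: hb].
Qed.

HB.instance Definition _ :=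
  GRing.isSubringClosed.Build R subring_span subring_span_closed.

Lemma subring_span_gen s : S s -> s \in subring_span.
Proof. by move=> Ss; apply/subring_spanP=> T _; apply. Qed.

Lemma subring_span_sub (T : {pred R}) : GRing.subring_closed T ->
  (forall s, S s -> s \in T) -> {subset subring_span <= T}.
Proof. by move=> hT ST r /subring_spanP; apply. Qed.

Record gen_ring := GenRing { gen_val :> R; _ : gen_val \in subring_span }.

HB.instance Definition _ := [isSub for gen_val].
HB.instance Definition _ := [Choice of gen_ring by <:].
HB.instance Definition _ := [SubChoice_isSubNzRing of gen_ring by <:].

End GeneratedSubring.

Section ModuleNotions.
Variables (R : nzRingType) (N : lmodType R).

Definition fin_gen : Prop :=
  exists s : seq N, forall u, exists c : 'I_(size s) -> R, u = \sum_i c i *: s`_i.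

(* [idealr_closed] and [prime_idealr_closed] define prime ideals of a
   commutative ring; they are applied to gr D, which is commutative although
   its type does not record it.                                               *)
Definition spec_point (P : {pred R}) : Prop :=
  idealr_closed P /\ prime_idealr_closed P.

(* The localization N_P is nonzero iff some u in N is killed by no element
   outside P.                                                                 *)
Definition support : set {pred R} := fun P =>
  spec_point P /\ exists u : N, forall a, a *: u = 0 -> a \in P.

End ModuleNotions.

(* Krull dimension of a closed subset Z of Spec R, whose irreducible closed
   subsets are the V(P) for P in Z; the empty set has dimension <= d for all d *)
Definition dim_le (R : nzRingType) (Z : set {pred R}) (d : nat) : Prop :=
  forall (l : nat) (P : nat -> {pred R}),
    (forall i, (i <= l)%N -> Z (P i)) ->
    (forall i, (i < l)%N ->
       {subset P i <= P i.+1} /\ exists a, a \in P i.+1 /\ a \notin P i) ->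
    (l <= d)%N.

(* M viewed as a module along f; the argument f only directs the inference of
   the module structure.                                                      *)
Definition restr (R R' : nzRingType) (f : {rmorphism R' -> R}) (M : lmodType R) :
  Type := M.

Arguments restr {R R'} f M.

Section RestrictionOfScalars.
Variables (R R' : nzRingType) (f : {rmorphism R' -> R}) (M : lmodType R).
Local Notation restr := (restr f M).

HB.instance Definition _ := GRing.Zmodule.on restr.

Definition restr_scale (a : R') (u : restr) : restr := f a *: (u : M).

Fact restr_scaleA a b u : restr_scale a (restr_scale b u) = restr_scale (a * b) u.
Proof. by rewrite /restr_scale scalerA rmorphM. Qed.
Fact restr_scale1 : left_id 1 restr_scale.
Proof. by move=> u; rewrite /restr_scale rmorph1 scale1r. Qed.
Fact restr_scaleDr : right_distributive restr_scale +%R.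
Proof. by move=> a u v; rewrite /restr_scale scalerDr. Qed.
Fact restr_scaleDl u : {morph restr_scale^~ u : a b / a + b}.
Proof. by move=> a b; rewrite /restr_scale rmorphD scalerDl. Qed.

HB.instance Definition _ := GRing.Zmodule_isLmodule.Build R' restr
  restr_scaleA restr_scale1 restr_scaleDr restr_scaleDl.

End RestrictionOfScalars.

Record ring_filt (R : nzRingType) := RingFilt {
  rfilt :> nat -> set R;
  rfilt1 : rfilt 0%N 1;
  rfiltB : forall p a b, rfilt p a -> rfilt p b -> rfilt p (a - b);
  rfiltS : forall p a, rfilt p a -> rfilt p.+1 a;
  rfiltM : forall p q a b, rfilt p a -> rfilt q b -> rfilt (p + q)%N (a * b)
}.

(* The associated graded ring, as the quotient of the Rees ring
   (+)_p F_p t^p, a subring of R[t], by its ideal (+)_p F_(p-1) t^p.          *)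
Section AssociatedGradedRing.
Variables (R : nzRingType) (F : ring_filt R).

Definition rfilt_pred (p : nat) : set R :=
  if p is q.+1 then F q else [set 0]%classic.

Lemma rfilt0 p : F p 0.
Proof.
elim: p => [|p IH]; last exact: rfiltS.
by rewrite -(subrr 1); apply: rfiltB; exact: rfilt1.
Qed.
Lemma rfiltD p a b : F p a -> F p b -> F p (a + b).
Proof.
move=> Fa Fb; rewrite -[b]opprK; apply: rfiltB => //.
by rewrite -sub0r; apply: rfiltB => //; exact: rfilt0.
Qed.
Lemma rfilt_pred0 p : rfilt_pred p 0.
Proof. by case: p => [|p] //; exact: rfilt0. Qed.
Lemma rfilt_predB p a b : rfilt_pred p a -> rfilt_pred p b -> rfilt_pred p (a - b).
Proof. by case: p => [/= -> -> |p]; [rewrite subrr|exact: rfiltB]. Qed.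
Lemma rfilt_predD p a b : rfilt_pred p a -> rfilt_pred p b -> rfilt_pred p (a + b).
Proof. by case: p => [/= -> -> |p]; [rewrite addr0|exact: rfiltD]. Qed.
Lemma rfilt_predMl p q a b :
  F p a -> rfilt_pred q b -> rfilt_pred (p + q)%N (a * b).
Proof.
case: q => [_ /= ->|q Fa Fb]; first by rewrite mulr0; exact: rfilt_pred0.
by rewrite addnS; exact: rfiltM.
Qed.
Lemma rfilt_predMr p q a b :
  rfilt_pred p a -> F q b -> rfilt_pred (p + q)%N (a * b).
Proof.
case: p => [/= -> _|p Fa Fb]; first by rewrite mul0r; exact: rfilt_pred0.
by rewrite addSn; exact: rfiltM.
Qed.

Definition rees_pred : {pred {poly R}} := fun f => `[< forall p, F p f`_p >].

Lemma reesP (f : {poly R}) : reflect (forall p, F p f`_p) (f \in rees_pred).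
Proof. exact: asboolP. Qed.

Lemma rfilt_sum (I : finType) p (G : I -> R) :
  (forall i, F p (G i)) -> F p (\sum_i G i).
Proof.
move=> FG; elim/big_ind: _ => [|a b|i _]; [exact: rfilt0|exact: rfiltD|exact: FG].
Qed.

Lemma rfilt_pred_sum (I : finType) p (G : I -> R) :
  (forall i, rfilt_pred p (G i)) -> rfilt_pred p (\sum_i G i).
Proof.
move=> FG; elim/big_ind: _ => [|a b|i _].
- exact: rfilt_pred0.
- exact: rfilt_predD.
- exact: FG.
Qed.

Fact rees_closed : GRing.subring_closed rees_pred.
Proof.
split=> [|f g /reesP Ff /reesP Fg|f g /reesP Ff /reesP Fg]; apply/reesP=> p.
- by rewrite coef1; case: p => [|p] /=; [exact: rfilt1|exact: rfilt0].
- by rewrite coefB; exact: rfiltB.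
- rewrite coefM; apply: rfilt_sum => i.
  rewrite -[in X in F X](subnKC (_ : (i <= p)%N)); last by rewrite -ltnS.
  exact: rfiltM.
Qed.

HB.instance Definition _ :=
  GRing.isSubringClosed.Build {poly R} rees_pred rees_closed.

Record rees := Rees { rees_val :> {poly R}; _ : rees_val \in rees_pred }.

HB.instance Definition _ := [isSub for rees_val].
HB.instance Definition _ := [Choice of rees by <:].
HB.instance Definition _ := [SubChoice_isSubNzRing of rees by <:].

Lemma rees_val0 : rees_val 0 = 0. Proof. exact: (raddf0 val). Qed.
Lemma rees_val1 : rees_val 1 = 1. Proof. exact: (rmorph1 val). Qed.
Lemma rees_valD f g : rees_val (f + g) = rees_val f + rees_val g.
Proof. exact: (raddfD val). Qed.
Lemma rees_valB f g : rees_val (f - g) = rees_val f - rees_val g.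
Proof. exact: (raddfB val). Qed.
Lemma rees_valM f g : rees_val (f * g) = rees_val f * rees_val g.
Proof. exact: (rmorphM val). Qed.

Lemma reesE (f : rees) p : F p f`_p.
Proof. by case: f => f /= /reesP. Qed.

Definition rees_shift : {pred rees} := fun f => `[< forall p, rfilt_pred p f`_p >].

Lemma rees_shiftP (f : rees) :
  reflect (forall p, rfilt_pred p f`_p) (f \in rees_shift).
Proof. exact: asboolP. Qed.

Fact rees_shift_closed : zmod_closed rees_shift.
Proof.
split=> [|f g /rees_shiftP Ff /rees_shiftP Fg]; apply/rees_shiftP=> p.
  by rewrite rees_val0 coef0; exact: rfilt_pred0.
by rewrite rees_valB coefB; exact: rfilt_predB.
Qed.

HB.instance Definition _ :=
  GRing.isZmodClosed.Build rees rees_shift rees_shift_closed.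

Lemma rees_shiftMl (f g : rees) : g \in rees_shift -> f * g \in rees_shift.
Proof.
move/rees_shiftP=> Fg; apply/rees_shiftP=> p.
rewrite rees_valM coefM; apply: rfilt_pred_sum => i.
rewrite -[in X in rfilt_pred X](subnKC (_ : (i <= p)%N)); last by rewrite -ltnS.
by apply: rfilt_predMl => //; exact: reesE.
Qed.

Lemma rees_shiftMr (f g : rees) : f \in rees_shift -> f * g \in rees_shift.
Proof.
move/rees_shiftP=> Ff; apply/rees_shiftP=> p.
rewrite rees_valM coefM; apply: rfilt_pred_sum => i.
rewrite -[in X in rfilt_pred X](subnKC (_ : (i <= p)%N)); last by rewrite -ltnS.
by apply: rfilt_predMr => //; exact: reesE.
Qed.

Definition gr : Type := Quotient.quot rees_shift.

HB.instance Definition _ := GRing.Zmodule.on gr.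

Definition gr_class (f : rees) : gr := \pi_(Quotient.quot rees_shift)%qT f.
Definition gr_repr (a : gr) : rees := repr (a : Quotient.quot rees_shift).

Lemma gr_reprK a : gr_class (gr_repr a) = a.
Proof. exact: reprK. Qed.

Lemma gr_classP (f g : rees) : gr_class f = gr_class g <-> f - g \in rees_shift.
Proof.
by rewrite Quotient.idealrBE /gr_class; split=> [->|/eqP].
Qed.

Lemma gr_classK (f : rees) : gr_repr (gr_class f) - f \in rees_shift.
Proof. by apply/gr_classP; rewrite gr_reprK. Qed.

Lemma gr_classB f g : gr_class (f - g) = gr_class f - gr_class g.
Proof. by rewrite /gr_class; exact: raddfB. Qed.
Lemma gr_classD f g : gr_class (f + g) = gr_class f + gr_class g.
Proof. by rewrite /gr_class; exact: raddfD. Qed.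

Definition gr_one : gr := gr_class 1.
Definition gr_mul (a b : gr) : gr := gr_class (gr_repr a * gr_repr b).

Lemma gr_classM f g : gr_mul (gr_class f) (gr_class g) = gr_class (f * g).
Proof.
apply/gr_classP; set f' := gr_repr _; set g' := gr_repr _.
have -> : f' * g' - f * g = f' * (g' - g) + (f' - f) * g.
  by rewrite mulrBr mulrBl addrA addrNK.
by apply: rpredD; [apply: rees_shiftMl|apply: rees_shiftMr]; exact: gr_classK.
Qed.

Fact gr_mulA : associative gr_mul.
Proof.
move=> a b c; rewrite -[a]gr_reprK -[b]gr_reprK -[c]gr_reprK.
by rewrite !gr_classM mulrA.
Qed.
Fact gr_mul1l : left_id gr_one gr_mul.
Proof. by move=> a; rewrite -[a]gr_reprK gr_classM mul1r. Qed.
Fact gr_mul1r : right_id gr_one gr_mul.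
Proof. by move=> a; rewrite -[a]gr_reprK gr_classM mulr1. Qed.
Fact gr_mulDl : left_distributive gr_mul +%R.
Proof.
move=> a b c; rewrite -[a]gr_reprK -[b]gr_reprK -[c]gr_reprK.
by rewrite -gr_classD !gr_classM mulrDl gr_classD.
Qed.
Fact gr_mulDr : right_distributive gr_mul +%R.
Proof.
move=> a b c; rewrite -[a]gr_reprK -[b]gr_reprK -[c]gr_reprK.
by rewrite -gr_classD !gr_classM mulrDr gr_classD.
Qed.
Fact gr_one_neq0 : gr_one != 0.
Proof.
have <- : gr_class 0 = 0 by rewrite /gr_class raddf0.
apply/eqP=> /gr_classP /rees_shiftP /(_ 0%N); rewrite subr0 rees_val1 coef1 /=.
by move/eqP; rewrite oner_eq0.
Qed.

HB.instance Definition _ := GRing.Zmodule_isNzRing.Build gr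
  gr_mulA gr_mul1l gr_mul1r gr_mulDl gr_mulDr gr_one_neq0.


End AssociatedGradedRing.

Record mod_filt (R : nzRingType) (F : ring_filt R) (N : lmodType R) := ModFilt {
  mfilt :> int -> set N;
  mfilt0 : forall j, mfilt j 0;
  mfiltB : forall j u v, mfilt j u -> mfilt j v -> mfilt j (u - v);
  mfiltS : forall j u, mfilt j u -> mfilt (j + 1) u;
  mfiltZ : forall p j a u, F p a -> mfilt j u -> mfilt (p%:Z + j) (a *: u)
}.

(* Polynomials acting on families of elements of N indexed by int, a family f
   standing for the formal sum of the f(j) t^j.                               *)
Section PolyAction.
Variables (R : nzRingType) (N : lmodType R).
Implicit Types (a b : {poly R}) (f g : int -> N).

Definition poly_act a f : int -> N :=
  fun j => \sum_(i < size a) a`_i *: f (j - i%:Z).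

Lemma poly_act_widen n a f j : (size a <= n)%N ->
  poly_act a f j = \sum_(i < n) a`_i *: f (j - i%:Z).
Proof.
move=> le_an; rewrite /poly_act (big_ord_widen n (fun i : nat => a`_i *: f (j - i%:Z))) //.
rewrite big_mkcond; apply: eq_bigr => i _; case: ifPn => //.
by rewrite -leqNgt => /leq_sizeP/(_ _ (leqnn _)) ->; rewrite scale0r.
Qed.

Lemma poly_actDl a b f j : poly_act (a + b) f j = poly_act a f j + poly_act b f j.
Proof.
have Ha := leq_maxl (size a) (size b); have Hb := leq_maxr (size a) (size b).
rewrite (poly_act_widen _ _ (size_polyD a b)) (poly_act_widen _ _ Ha).
rewrite (poly_act_widen _ _ Hb) -big_split; apply: eq_bigr => i _ /=.
by rewrite coefD scalerDl.
Qed.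

Lemma poly_actDr a f g j : poly_act a (f + g) j = poly_act a f j + poly_act a g j.
Proof. by rewrite -big_split; apply: eq_bigr => i _ /=; rewrite -scalerDr. Qed.

Lemma poly_act0 f j : poly_act 0 f j = 0.
Proof. by rewrite /poly_act size_poly0 big_ord0. Qed.

Lemma poly_actX a f j : poly_act (a * 'X) f j = poly_act a f (j - 1).
Proof.
rewrite (@poly_act_widen (size a).+1); last first.
  by apply: leq_trans (size_polyMleq _ _) _; rewrite size_polyX addn2.
rewrite big_ord_recl coefMX scale0r add0r; apply: eq_bigr => i _.
by rewrite coefMX /=; congr (_ *: f _); rewrite /bump /=; lia.
Qed.

Lemma poly_actC c a f j : poly_act (c%:P * a) f j = c *: poly_act a f j.
Proof.
rewrite (@poly_act_widen (size a)); last by rewrite mul_polyC size_scale_leq.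
by rewrite scaler_sumr; apply: eq_bigr => i _; rewrite coefCM scalerA.
Qed.

Lemma poly_act1 f j : poly_act 1 f j = f j.
Proof. by rewrite /poly_act size_poly1 big_ord1 coef1 scale1r subr0. Qed.

Lemma poly_actM a b f j : poly_act (a * b) f j = poly_act a (poly_act b f) j.
Proof.
elim/poly_ind: a j => [|a c IH] j; first by rewrite mul0r !poly_act0.
rewrite mulrDl -mulrA -commr_polyX mulrA !poly_actDl !poly_actX IH poly_actC.
by congr (_ + _); rewrite -[c%:P]mulr1 poly_actC poly_act1.
Qed.

End PolyAction.

(* The associated graded module, as the quotient of the Rees module
   (+)_j G_j t^j by (+)_j G_(j-1) t^j.                                        *)
Section AssociatedGradedModule.
Variables (R : nzRingType) (F : ring_filt R) (N : lmodType R) (G : mod_filt F N).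

Definition fin_supp (f : int -> N) : Prop :=
  exists b : nat, forall j : int, (b < `|j|)%N -> f j = 0.

Definition mrees_pred : {pred int -> N} :=
  fun f => `[< fin_supp f /\ forall j, G j (f j) >].

Lemma mreesP f : reflect (fin_supp f /\ forall j, G j (f j)) (f \in mrees_pred).
Proof. exact: asboolP. Qed.

Fact mrees_closed : zmod_closed mrees_pred.
Proof.
split=> [|f g /mreesP[[b fb] Gf] /mreesP[[c gc] Gg]]; apply/mreesP; split.
- by exists 0%N.
- by move=> j; exact: mfilt0.
- exists (b + c)%N => j bcj.
  change (f j - g j = 0); rewrite fb ?gc ?subrr //.
  + exact: leq_ltn_trans (leq_addl _ _) bcj.
  + exact: leq_ltn_trans (leq_addr _ _) bcj.
- by move=> j; apply: mfiltB.
Qed.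

HB.instance Definition _ :=
  GRing.isZmodClosed.Build (int -> N) mrees_pred mrees_closed.

Record mrees := MRees { mrees_val :> int -> N; _ : mrees_val \in mrees_pred }.

HB.instance Definition _ := [isSub for mrees_val].
HB.instance Definition _ := [Choice of mrees by <:].
HB.instance Definition _ := [SubChoice_isSubZmodule of mrees by <:].

Lemma mrees_supp (f : mrees) : fin_supp f.
Proof. by case: f => f /= /mreesP[]. Qed.
Lemma mreesE (f : mrees) j : G j (f j).
Proof. by case: f => f /= /mreesP[]. Qed.

Definition mrees_shift : {pred mrees} := fun f => `[< forall j, G (j - 1) (f j) >].

Lemma mrees_shiftP (f : mrees) :
  reflect (forall j, G (j - 1) (f j)) (f \in mrees_shift).
Proof. exact: asboolP. Qed.

Fact mrees_shift_closed : zmod_closed mrees_shift.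
Proof.
split=> [|f g /mrees_shiftP Gf /mrees_shiftP Gg]; apply/mrees_shiftP=> j.
  exact: mfilt0.
by apply: mfiltB.
Qed.

HB.instance Definition _ :=
  GRing.isZmodClosed.Build mrees mrees_shift mrees_shift_closed.

Lemma mfiltD j u v : G j u -> G j v -> G j (u + v).
Proof.
move=> Gu Gv; rewrite -[v]opprK; apply: mfiltB => //.
by rewrite -sub0r; apply: mfiltB => //; exact: mfilt0.
Qed.

Lemma mfilt_sum (I : finType) j (u : I -> N) :
  (forall i, G j (u i)) -> G j (\sum_i u i).
Proof.
move=> Gu; elim/big_ind: _ => [|v w|i _]; [exact: mfilt0|exact: mfiltD|exact: Gu].
Qed.

Fact mrees_act_subproof (a : rees F) (f : mrees) : poly_act a f \in mrees_pred.
Proof.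
apply/mreesP; split.
  have [b fb] := mrees_supp f; exists (b + size a)%N => j bj.
  rewrite /poly_act big1 // => i _; rewrite fb ?scaler0 //.
  by have := ltn_ord i; lia.
move=> j; apply: mfilt_sum => i.
have -> : j = i%:Z + (j - i%:Z) by rewrite addrC subrK.
by rewrite [X in f X]addrC addKr; apply: mfiltZ; [exact: reesE|exact: mreesE].
Qed.

Definition mrees_act (a : rees F) (f : mrees) : mrees :=
  MRees (mrees_act_subproof a f).

Lemma mrees_eq (f g : mrees) : f =1 g -> f = g.
Proof. by move=> fg; apply: val_inj; apply: funext. Qed.

Lemma mrees_actDl a b f : mrees_act (a + b) f = mrees_act a f + mrees_act b f.
Proof. by apply: mrees_eq => j; exact: poly_actDl. Qed.
Lemma mrees_actDr a f g : mrees_act a (f + g) = mrees_act a f + mrees_act a g.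
Proof. by apply: mrees_eq => j; exact: poly_actDr. Qed.
Lemma mrees_actM a b f : mrees_act (a * b) f = mrees_act a (mrees_act b f).
Proof. by apply: mrees_eq => j; exact: poly_actM. Qed.
Lemma mrees_act1 f : mrees_act 1 f = f.
Proof. by apply: mrees_eq => j; exact: poly_act1. Qed.

Lemma mrees_shift_actl (a : rees F) f :
  rees_shift a -> mrees_act a f \in mrees_shift.
Proof.
move=> /(rees_shiftP a) Fa; apply/mrees_shiftP => j; apply: mfilt_sum => i.
case: i => -[|i] lt_i /=; first by rewrite (Fa 0%N) scale0r; exact: mfilt0.
have := Fa i.+1 => /= Fai.
have -> : j - 1 = i%:Z + (j - i.+1%:Z) by lia.
by apply: mfiltZ => //; exact: mreesE.
Qed.

Lemma mrees_shift_actr a f : f \in mrees_shift -> mrees_act a f \in mrees_shift.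
Proof.
move=> /mrees_shiftP Gf; apply/mrees_shiftP => j; apply: mfilt_sum => i.
have -> : j - 1 = i%:Z + (j - i%:Z - 1) by lia.
by apply: mfiltZ; [exact: reesE|exact: Gf].
Qed.

Definition gr_mod : Type := Quotient.quot mrees_shift.

HB.instance Definition _ := GRing.Zmodule.on gr_mod.

Definition grm_class (f : mrees) : gr_mod := \pi_(Quotient.quot mrees_shift)%qT f.
Definition grm_repr (u : gr_mod) : mrees := repr (u : Quotient.quot mrees_shift).

Lemma grm_reprK u : grm_class (grm_repr u) = u.
Proof. exact: reprK. Qed.

Lemma grm_classP f g : grm_class f = grm_class g <-> f - g \in mrees_shift.
Proof. by rewrite Quotient.idealrBE /grm_class; split=> [->|/eqP]. Qed.

Lemma grm_classK f : grm_repr (grm_class f) - f \in mrees_shift.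
Proof. by apply/grm_classP; rewrite grm_reprK. Qed.

Lemma grm_classD f g : grm_class (f + g) = grm_class f + grm_class g.
Proof. by rewrite /grm_class; exact: raddfD. Qed.

Definition gr_scale (a : gr F) (u : gr_mod) : gr_mod :=
  grm_class (mrees_act (gr_repr a) (grm_repr u)).

Lemma gr_scaleE a f : gr_scale (gr_class a) (grm_class f) = grm_class (mrees_act a f).
Proof.
apply/grm_classP; set a' := gr_repr _; set f' := grm_repr _.
have -> : mrees_act a' f' - mrees_act a f =
          mrees_act a' (f' - f) + mrees_act (a' - a) f.
  apply/eqP; rewrite subr_eq -addrA -mrees_actDl subrK -mrees_actDr subrK.
  by [].
by apply: rpredD; [apply: mrees_shift_actr; exact: grm_classK
                  |apply: mrees_shift_actl; exact: gr_classK].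
Qed.

Fact gr_scaleA a b u : gr_scale a (gr_scale b u) = gr_scale (a * b) u.
Proof.
rewrite -[a]gr_reprK -[b]gr_reprK -[u]grm_reprK.
rewrite [X in _ = gr_scale X _](gr_classM (gr_repr a) (gr_repr b)).
by rewrite !gr_scaleE mrees_actM.
Qed.
Fact gr_scale1 : left_id 1 gr_scale.
Proof. by move=> u; rewrite -[u]grm_reprK gr_scaleE mrees_act1. Qed.
Fact gr_scaleDr : right_distributive gr_scale +%R.
Proof.
move=> a u v; rewrite -[a]gr_reprK -[u]grm_reprK -[v]grm_reprK.
by rewrite -grm_classD !gr_scaleE mrees_actDr grm_classD.
Qed.
Fact gr_scaleDl u : {morph gr_scale^~ u : a b / a + b}.
Proof.
move=> a b; rewrite -[a]gr_reprK -[b]gr_reprK -[u]grm_reprK.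
by rewrite -gr_classD !gr_scaleE mrees_actDl grm_classD.
Qed.

HB.instance Definition _ := GRing.Zmodule_isLmodule.Build (gr F) gr_mod
  gr_scaleA gr_scale1 gr_scaleDr gr_scaleDl.

End AssociatedGradedModule.

Section CharacteristicVariety.
Variables (R : nzRingType) (F : ring_filt R) (N : lmodType R).

(* For R a ring of differential operators with its order filtration, F_0 = O_X,
   so the third clause says that the pieces are finitely generated, that is
   coherent, over O_X.                                                        *)
Definition good_filt (G : mod_filt F N) : Prop :=
  [/\ forall u, exists j, G j u,
      exists j0, forall j u, (j < j0)%R -> G j u -> u = 0,
      forall j, exists s : seq N, (forall u, u \in s -> G j u) /\
        forall u, G j u -> exists c : 'I_(size s) -> R,
          (forall i, F 0%N (c i)) /\ u = \sum_i c i *: s`_i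
    & fin_gen (gr_mod G)].

(* The support of gr N does not depend on the good filtration.                *)
Definition Car : set {pred gr F} := fun P =>
  exists G : mod_filt F N, good_filt G /\ support (gr_mod G) P.

End CharacteristicVariety.

Arguments Car {R} F N P.

(* The ring generated by O_X = A and operators theta_1, ..., theta_n on A,
   with the smallest multiplicative filtration for which functions have order
   0 and the theta_i have order at most 1.  When the theta_i are the
   coordinate (logarithmic) vector fields, they commute and [theta_i, a] =
   theta_i(a), so that F_p is the A-span of the theta^alpha, |alpha| <= p.    *)
Section DifferentialOperators.
Variables (k : comNzRingType) (A : comAlgType k) (n : nat).
Variable theta : 'I_n -> kend A.

Inductive op_gens : kend A -> Prop :=
| OpFun a : op_gens (mulop a)
| OpVec i : op_gens (theta i).

Definition diff_ring : Type := gen_ring op_gens.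

HB.instance Definition _ := GRing.NzRing.on diff_ring.

Inductive op_order_le : nat -> kend A -> Prop :=
| OrdFun p a : op_order_le p (mulop a)
| OrdVec p i : op_order_le p.+1 (theta i)
| OrdSub p P Q : op_order_le p P -> op_order_le p Q -> op_order_le p (P - Q)
| OrdMul p q P Q :
    op_order_le p P -> op_order_le q Q -> op_order_le (p + q) (P * Q).

Definition order_le (p : nat) : set diff_ring :=
  fun P => op_order_le p (gen_val P).

Lemma op_order_le_one p : op_order_le p 1.
Proof.
have -> : 1 = mulop (1 : A) by apply: kend_eq => a; rewrite /= mul1r.
exact: OrdFun.
Qed.

Fact order_le1 : order_le 0 1.
Proof. exact: op_order_le_one. Qed.
Fact order_leB p P Q : order_le p P -> order_le p Q -> order_le p (P - Q).
Proof. exact: OrdSub. Qed.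
Fact order_leS p P : order_le p P -> order_le p.+1 P.
Proof.
by move=> hP; rewrite /order_le -[gen_val P]mul1r -add1n; apply: OrdMul => //;
  exact: op_order_le_one.
Qed.
Fact order_leM p q P Q :
  order_le p P -> order_le q Q -> order_le (p + q) (P * Q).
Proof. exact: OrdMul. Qed.

Definition order_filt : ring_filt diff_ring :=
  RingFilt order_le1 order_leB order_leS order_leM.

(* By Bernstein's inequality, the bound is an equality unless M = 0, when the
   theta_i are the coordinate vector fields.                                  *)
Definition holonomic (M : lmodType diff_ring) : Prop :=
  fin_gen M /\ dim_le (Car order_filt M) n.

(* M is not required to be finitely generated; its submodules are given by
   injective linear maps M0 -> M.                                             *)
Definition log_holonomic (M : lmodType diff_ring) : Prop :=
  forall (M0 : lmodType diff_ring) (iota : {linear M0 -> M}),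
    injective iota -> fin_gen M0 -> dim_le (Car order_filt M0) n.

End DifferentialOperators.

Section LogOperators.
Variables (k : comNzRingType) (A : comAlgType k) (n : nat).
Variable f : {lrmorphism {mpoly k[n]} -> A}.

Definition coord (i : 'I_n) : A := f 'X_i.

Definition coord_vector_fields (d : 'I_n -> kend A) : Prop :=
  (forall i, derivation (d i)) /\
  (forall i j, d i (coord j) = (i == j)%:R).

Variables (m : nat) (d : 'I_n -> kend A).

Definition log_vector_fields (i : 'I_n) : kend A :=
  if (i < m)%N then mulop (coord i) * d i else d i.

Local Notation DX := (diff_ring d).
Local Notation DXlog := (diff_ring log_vector_fields).

Fact log_incl_subproof (P : DXlog) : gen_val P \in subring_span (op_gens d).
Proof.
apply: (subring_span_sub _ _ (valP P)).
  exact: subring_span_closed.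
move=> _ [a|i]; first by apply: subring_span_gen; exact: OpFun.
rewrite /log_vector_fields; case: ifP => _.
  by apply: rpredM; apply: subring_span_gen; [exact: OpFun|exact: OpVec].
by apply: subring_span_gen; exact: OpVec.
Qed.

Definition log_incl (P : DXlog) : DX := GenRing (log_incl_subproof P).

Fact log_incl_zmod_morphism : zmod_morphism log_incl.
Proof. by move=> P Q; apply: val_inj. Qed.
Fact log_incl_monoid_morphism : monoid_morphism log_incl.
Proof. by split=> [|P Q]; apply: val_inj. Qed.

HB.instance Definition _ :=
  GRing.isZmodMorphism.Build DXlog DX log_incl log_incl_zmod_morphism.
HB.instance Definition _ :=
  GRing.isMonoidMorphism.Build DXlog DX log_incl log_incl_monoid_morphism.

End LogOperators.

Arguments log_incl {k A n} f m d P.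

(* Main.v *)
(** The proof compares growth rates over k. Choose generators a_1, ..., a_r of
    the algebra A and w_1, ..., w_q of M, and let e_mu run over the vectors
    a^alpha d^beta w_i. If the span of the e_mu of degree at most s has
    dimension O(s^n), then the bound passes to every submodule over the smaller
    ring of logarithmic operators: a chain of primes P_0 < ... < P_l in the
    characteristic variety of M_0 gives y_i in P_(i+1) \ P_i whose monomials act
    freely on a vector of gr M_0 whose annihilator lies in P_0. Lifting to the
    Rees module yields about s^l independent vectors of degree O(s) in M, hence
    l <= n.

    For the growth of M, order the e_mu by |beta|, then by total degree, then
    lexicographically, and call e_mu standard if it is not a combination of
    smaller ones. By Dickson's lemma the standard e_mu with |alpha| + w |beta|
    <= s span all the e_mu with |alpha| + w |beta| <= s, once w is large. If
    there are more than O(s^n) of them, they contain a translate of a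
    coordinate cone of dimension n + 1, so some u in gr M is acted on freely by
    n + 1 of the variables of gr D. The same reduction, with coefficients in a
    polynomial ring instead of k, is a form of generic freeness: it shows that
    one of these variables can be specialized to a constant modulo a prime
    without creating relations among the others. This gives a chain of n + 2
    primes of gr D containing the annihilator of u, against holonomicity. *)

Require Import Defs.
From HB Require Import structures.
From mathcomp Require Import all_boot all_order all_algebra.
From mathcomp Require Import boolp classical_sets functions.
From mathcomp Require Import mpoly.
From mathcomp Require Import zify.

Set Implicit Arguments.
Unset Strict Implicit.
Unset Printing Implicit Defensive.

Import GRing.Theory.
Local Open Scope ring_scope.

(** * Upward closed sets of monomials *)

Section UpwardClosedSets.
Variable N : nat.
Implicit Types (m g : 'X_{1..N}) (L : 'X_{1..N} -> Prop) (J : {set 'I_N}).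

Definition upward_closed L := forall m m', (m <= m')%MM -> L m -> L m'.

(** The inductions on the number of variables keep all [N] variables and restrict instead the
    exponents on which [L] depends. *)
Definition depends_below k L :=
  forall m m', (forall i : 'I_N, (i < k)%N -> m i = m' i) -> L m -> L m'.

Definition mset m (x : 'I_N) t : 'X_{1..N} :=
  [multinom (if i == x then t else m i) | i < N].

Lemma msetE m x t i : mset m x t i = if i == x then t else m i.
Proof. exact: mnmE. Qed.

Lemma mset_id m x : mset m x (m x) = m.
Proof. by apply/mnmP => i; rewrite msetE; case: eqP => [->|]. Qed.

Lemma mset_le m m' x t t' : (m <= m')%MM -> (t <= t')%N -> (mset m x t <= mset m' x t')%MM.
Proof.
by move=> /mnm_lepP mm' tt'; apply/mnm_lepP => i; rewrite !msetE; case: eqP.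
Qed.

Lemma slice_upward L x t : upward_closed L -> upward_closed (fun m => L (mset m x t)).
Proof. by move=> upL m m' mm'; apply: upL; apply: mset_le. Qed.

Lemma slice_depends L (x : 'I_N) t :
  depends_below x.+1 L -> depends_below x (fun m => L (mset m x t)).
Proof.
move=> dL m m' mm'; apply: dL => i; rewrite ltnS leq_eqVlt !msetE -(inj_eq val_inj) /=.
by case: eqP => //= _ /mm'.
Qed.

Definition generated_by (s : seq 'X_{1..N}) L :=
  forall m, L m <-> exists2 g, g \in s & (g <= m)%MM.

(** The union of the chain is finitely generated by the first hypothesis, and its finitely many
    generators all occur at some finite stage. *)
Lemma increasing_stable k (Lt : nat -> 'X_{1..N} -> Prop) :
  (forall L, upward_closed L -> depends_below k L -> exists s, generated_by s L) ->
  (forall t, upward_closed (Lt t)) -> (forall t, depends_below k (Lt t)) ->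
  (forall t t' m, (t <= t')%N -> Lt t m -> Lt t' m) ->
  exists t0, forall t m, Lt t m -> Lt t0 m.
Proof.
move=> fg up dp mono; pose L m := exists t, Lt t m.
have [||s sL] := fg L.
- by move=> m m' mm' [t Lm]; exists t; apply: up mm' Lm.
- by move=> m m' mm' [t Lm]; exists t; apply: dp mm' Lm.
have: exists t0, forall g, g \in s -> Lt t0 g.
  have: forall g, g \in s -> L g by move=> g gs; apply/sL; exists g; rewrite ?lepm_refl.
  elim: s {sL} => [_|g s IH sL]; first by exists 0%N.
  have [t1 s1] := IH (fun h hs => sL h (@mem_behead _ (g :: s) h hs)).
  have [t2 g2] := sL g (mem_head g s).
  exists (maxn t1 t2) => h; rewrite inE => /predU1P[->|hs].
    by apply: mono g2; exact: leq_maxr.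
  by apply: mono (s1 _ hs); exact: leq_maxl.
case=> t0 st0; exists t0 => t m Lm.
by have /sL[g gs gm] : L m by [exists t]; apply: up gm (st0 g gs).
Qed.

(** The slices of [L] at exponent [t] of the last variable [x] increase with [t] and stabilize at
    some [t0]. Generators of the slices with [t <= t0], each given the exponent [t] in [x], generate
    [L]. *)
Lemma dickson_below k L : (k <= N)%N ->
  upward_closed L -> depends_below k L -> exists s, generated_by s L.
Proof.
elim: k L => [L _ up dp|k IH L kN up dp].
  have [L0|L0] := pselect (L 0%MM).
    exists [:: 0%MM] => m; split=> [_|[g _ gm]]; last by apply: dp L0.
    by exists 0%MM; rewrite ?mem_head //; apply/mnm_lepP => i; rewrite mnm0E.
  by exists [::] => m; split=> [Lm|[]//]; case: L0; apply: dp Lm.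
have {}IH := fun L => IH L (ltnW kN); pose x := Ordinal kN.
pose Lt t m := L (mset m x t).
have upt t : upward_closed (Lt t) by apply: slice_upward.
have dpt t : depends_below k (Lt t) by apply: (@slice_depends _ x).
have [|t0 stable] := increasing_stable IH upt dpt.
  by move=> t t' m tt'; apply: up (mset_le _ (lepm_refl m) tt').
have [gens gensP] := choice (fun t => IH (Lt t) (upt t) (dpt t)).
exists [seq mset g x t | t <- iota 0 t0.+1, g <- gens t] => m; split.
  move=> Lm; pose t := minn (m x) t0.
  have Ltm : Lt t m.
    rewrite /t; case: (leqP (m x) t0) => _; first by rewrite /Lt mset_id.
    by apply: (stable (m x)); rewrite /Lt mset_id.
  have [g gs gm] := (gensP t m).1 Ltm.
  exists (mset g x t).
    by apply/allpairsPdep; exists t, g; rewrite mem_iota /= ltnS geq_minr.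
  by rewrite -[m in X in _ X](mset_id m x); apply: mset_le gm (geq_minl _ _).
case=> _ /allpairsPdep[t [g [_ gs ->]]] gm; apply: up gm _.
by apply/(gensP t g); exists g; rewrite ?lepm_refl.
Qed.

Lemma dickson L : upward_closed L -> exists s, generated_by s L.
Proof.
move=> up; apply: (dickson_below (leqnn N)) => // m m' mm'; apply: up.
by apply/mnm_lepP => i; rewrite mm'.
Qed.

(* The coset [m + N^J] of a coordinate face. *)
Definition in_cone m J m' := (m <= m')%MM /\ forall i, i \notin J -> m' i = m i.

(** The slices along the last variable [x] are constant from [t0] on, so there the cones of the
    slice at [t0] extend in the direction [x]. Each of the finitely many slices below [t0]
    contributes its own cones at a fixed exponent of [x]. *)
Lemma complement_cones_below k L : (k <= N)%N ->
  upward_closed L -> depends_below k L ->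
  exists s : seq ('X_{1..N} * {set 'I_N}),
    (forall c, c \in s ->
       (forall i : 'I_N, (k <= i)%N -> c.1 i = 0%N /\ i \notin c.2) /\
       (forall m, in_cone c.1 c.2 m -> ~ L m)) /\
    (forall m, (forall i : 'I_N, (k <= i)%N -> m i = 0%N) -> ~ L m ->
       exists2 c, c \in s & in_cone c.1 c.2 m).
Proof.
elim: k L => [L _ up dp|k IH L kN up dp].
  have [L0|L0] := pselect (L 0%MM).
    by exists [::]; split=> // m m0; case; apply: dp L0.
  exists [:: (0%MM, finset.set0)]; split=> [c|m m0 _].
    rewrite inE => /eqP-> /=; split=> [i _|m _ Lm]; first by rewrite mnm0E inE.
    by case: L0; apply: dp Lm.
  exists (0%MM, finset.set0); rewrite ?mem_head //.
  by split=> [|i _ /=]; [apply/mnm_lepP => i|]; rewrite mnm0E ?m0.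
have {}IH := fun L => IH L (ltnW kN); pose x := Ordinal kN.
pose Lt t m := L (mset m x t).
have upt t : upward_closed (Lt t) by apply: slice_upward.
have dpt t : depends_below k (Lt t) by apply: (@slice_depends _ x).
have [||t0 stable] := increasing_stable _ upt dpt.
- by move=> L' up' dp'; apply: (dickson_below (ltnW kN)).
- by move=> t t' m tt'; apply: up (mset_le _ (lepm_refl m) tt').
have [cs csP] := choice (fun t => IH (Lt t) (upt t) (dpt t)).
have ltx (i : 'I_N) : (k < i)%N -> (i == x) = false.
  by move=> ki; apply/eqP => ix; move: ki; rewrite ix /= ltnn.
have msetx m : mset (mset m x 0) x (m x) = m.
  by apply/mnmP => i; rewrite !msetE; case: eqP => [->|].
exists ([seq (mset c.1 x t0, x |: c.2) | c <- cs t0] ++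
        [seq (mset c.1 x t, c.2) | t <- iota 0 t0, c <- cs t]).
split=> [c|m m0 Lm].
  rewrite mem_cat => /orP[/mapP[d ds ->]|/allpairsPdep[t [d [_ ds ->]]]] /=.
    have [d0 dL] := (csP t0).1 d ds; split=> [i ki|m [/mnm_lepP dm dJ] Lm].
      by rewrite msetE ltx // in_setU1 negb_or ltx // (d0 i (ltnW ki)).1 (d0 i (ltnW ki)).2.
    apply: (dL (mset m x 0)).
      split=> [|i iJ]; first apply/mnm_lepP => i; rewrite msetE; case: eqP => [->|/eqP ix].
      + by rewrite (d0 x (leqnn _)).1.
      + by have := dm i; rewrite msetE (negbTE ix).
      + by rewrite (d0 x (leqnn _)).1.
      + by rewrite dJ ?msetE ?(negbTE ix) // in_setU1 negb_or ix.
    by apply: (stable (m x)); rewrite /Lt msetx.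
  have [d0 dL] := (csP t).1 d ds; split=> [i ki|m [/mnm_lepP dm dJ] Lm].
    by rewrite msetE ltx // (d0 i (ltnW ki)).1 (d0 i (ltnW ki)).2.
  have mxt : m x = t by rewrite dJ ?msetE ?eqxx // (d0 x (leqnn _)).2.
  apply: (dL (mset m x 0)); last by rewrite /Lt -mxt msetx.
  split=> [|i iJ]; first apply/mnm_lepP => i; rewrite msetE; case: eqP => [->|/eqP ix].
  + by rewrite (d0 x (leqnn _)).1.
  + by have := dm i; rewrite msetE (negbTE ix).
  + by rewrite (d0 x (leqnn _)).1.
  + by rewrite dJ ?msetE ?(negbTE ix).
pose t := minn (m x) t0.
have [||[d J] ds [/mnm_lepP dm dJ]] := (csP t).2 (mset m x 0).
- move=> i ki; rewrite msetE; case: eqP => // /eqP ix; apply: m0.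
  by rewrite ltn_neqAle ki andbT eq_sym; apply: contra ix => /eqP ik; apply/eqP/val_inj.
- rewrite /Lt; set m' := mset _ x t => Lm'; apply: Lm; apply: up Lm'.
  by apply/mnm_lepP => i; rewrite !msetE; case: eqP => [->|]; rewrite ?geq_minl.
have [d0 _] := (csP t).1 _ ds.
rewrite /= in dm dJ d0.
case: (leqP t0 (m x)) => [t0m|mt0].
  exists (mset d x t0, x |: J).
    rewrite mem_cat; apply/orP; left; apply/mapP; exists (d, J) => //=.
    by move: ds; rewrite /t (minn_idPr t0m).
  split=> /= [|i]; first apply/mnm_lepP => i; rewrite msetE.
    by have := dm i; rewrite msetE; case: eqP => [->|].
  rewrite in_setU1 negb_or => /andP[ix iJ]; rewrite (negbTE ix) -dJ //.
  by rewrite msetE (negbTE ix).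
have tE : t = m x by rewrite /t (minn_idPl (ltnW mt0)).
exists (mset d x t, J).
  rewrite mem_cat; apply/orP; right; apply/allpairsPdep; exists t, (d, J).
  by split=> //; rewrite mem_iota tE.
split=> /= [|i iJ]; first apply/mnm_lepP => i; rewrite msetE tE.
  by have := dm i; rewrite msetE; case: eqP => [->|].
by case: eqP => [->//|/eqP ix]; rewrite -dJ // msetE (negbTE ix).
Qed.

Lemma complement_cones L : upward_closed L ->
  exists s : seq ('X_{1..N} * {set 'I_N}),
    (forall c, c \in s -> forall m, in_cone c.1 c.2 m -> ~ L m) /\
    (forall m, ~ L m -> exists2 c, c \in s & in_cone c.1 c.2 m).
Proof.
move=> up; have [|s [sL Ls]] := complement_cones_below (leqnn N) up.
  by move=> m m' mm'; apply: up; apply/mnm_lepP => i; rewrite mm'.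
exists s; split=> [c cs|m]; first by case: (sL c cs).
by apply: Ls => i; rewrite leqNgt ltn_ord.
Qed.

(** A point of the cone is determined by its exponents in [J], each of which is at most [s]. *)
Lemma cone_count m J s : exists r : seq 'X_{1..N},
  (size r <= s.+1 ^ #|J|)%N /\
  forall m', in_cone m J m' -> (mdeg m' <= s)%N -> m' \in r.
Proof.
pose F (f : {ffun 'I_N -> 'I_s.+1}) : 'X_{1..N} :=
  [multinom if i \in J then f i : nat else m i | i < N].
exists [seq F f | f <- enum (pffun_on ord0 (mem J) predT)]; split.
  by rewrite size_map -cardE card_pffun_on card_ord.
move=> m' [mm' mJ] m's.
have le_s i : (m' i <= s)%N.
  by apply: leq_trans m's; rewrite mdegE (bigD1 i) //= leq_addr.
apply/mapP; exists [ffun i => if i \in J then inord (m' i) else ord0].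
  rewrite mem_enum; apply/pffun_onP; split=> //.
  by apply/fintype.subsetP => i; rewrite inE ffunE; case: (i \in J) => //; rewrite eqxx.
apply/mnmP => i; rewrite mnmE ffunE; case: ifPn => [iJ|/mJ//].
by rewrite iJ inordK ?ltnS ?le_s.
Qed.

(** If every cone of the decomposition has dimension at most [e], counting cone by cone gives the
    bound. Otherwise some cone is too large, and a face of it has dimension exactly [e.+1]. *)
Lemma complement_growth L e : upward_closed L ->
  (exists C, forall s, exists r : seq 'X_{1..N},
     (size r <= C * s.+1 ^ e)%N /\ forall m, ~ L m -> (mdeg m <= s)%N -> m \in r) \/
  (exists m J, #|J| = e.+1 /\ forall m', in_cone m J m' -> ~ L m').
Proof.
move=> up; have [cs [csL Lcs]] := complement_cones up.
have [|small] := pselect (exists2 c, c \in cs & (e < #|c.2|)%N).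
  case=> -[m J] cs_c; rewrite /= => eJ; right.
  have [K KJ cK] : exists2 K : {set 'I_N}, K \subset J & #|K| = e.+1.
    exists [set x in take e.+1 (enum J)].
      by apply/fintype.subsetP => x; rewrite inE => /mem_take; rewrite mem_enum.
    rewrite cardsE; have /card_uniqP-> := take_uniq e.+1 (enum_uniq J).
    by rewrite size_takel // -cardE.
  exists m, K; split=> // m' [mm' mK]; apply: (csL _ cs_c); split=> //= i iJ.
  by apply: mK; apply: contra iJ; apply: (fintype.subsetP KJ).
left; exists (size cs) => s.
have {}small c : c \in cs -> (#|c.2| <= e)%N.
  by move=> c_cs; rewrite leqNgt; apply/negP => ce; apply: small; exists c.
have [r [sr rP]] : exists r : seq 'X_{1..N}, (size r <= size cs * s.+1 ^ e)%N /\
    forall c m, c \in cs -> in_cone c.1 c.2 m -> (mdeg m <= s)%N -> m \in r.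
  elim: cs small {csL Lcs} => [|c cs IH] small; first by exists [::].
  have [|r [sr rP]] := IH; first by move=> d dcs; apply: small; rewrite inE dcs orbT.
  have [r' [sr' rP']] := cone_count c.1 c.2 s.
  exists (r' ++ r); rewrite size_cat mulSn; split.
    apply: leq_add sr; apply: leq_trans sr' _.
    by rewrite leq_pexp2l // small // mem_head.
  move=> d m; rewrite inE mem_cat => /predU1P[->|dcs] md ms.
    by rewrite rP'.
  by rewrite (rP d) ?orbT.
by exists r; split=> // m Lm ms; have [c c_cs cm] := Lcs m Lm; apply: rP cm ms.
Qed.

End UpwardClosedSets.

(** * Standard monomials *)

Section StandardMonomials.
Variables (A : idomainType) (V : lmodType A) (N0 : V -> Prop).
Hypothesis N0_closed : forall a u v, N0 u -> N0 v -> N0 (a *: u + v).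
Hypothesis N0_0 : N0 0.
Variables (N q : nat) (p : pred 'I_N).
Local Notation index := ('X_{1..N} * 'I_q)%type.
Variables (e : index -> V).

(** Spans are taken modulo the submodule [N0], which is later zero, an ideal, or a lower piece of a
    filtration. *)
Inductive mspan (X : index -> Prop) : V -> Prop :=
| MspanBase v : N0 v -> mspan X v
| MspanGen x : X x -> mspan X (e x)
| MspanLin a u v : mspan X u -> mspan X v -> mspan X (a *: u + v).

Lemma mspan0 X : mspan X 0. Proof. exact: MspanBase. Qed.
Lemma mspanZ X a v : mspan X v -> mspan X (a *: v).
Proof. by move=> Xv; rewrite -[_ *: _]addr0; apply: MspanLin => //; exact: mspan0. Qed.
Lemma mspanD X u v : mspan X u -> mspan X v -> mspan X (u + v).
Proof. by move=> Xu Xv; rewrite -[u]scale1r; exact: MspanLin. Qed.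
Lemma mspanB X u v : mspan X u -> mspan X v -> mspan X (u - v).
Proof. by move=> Xu Xv; rewrite addrC -scaleN1r; exact: MspanLin. Qed.
Lemma mspan_sum X (I : eqType) (r : seq I) (F : I -> V) :
  (forall i, i \in r -> mspan X (F i)) -> mspan X (\sum_(i <- r) F i).
Proof.
move=> XF; rewrite big_seq; elim/big_ind: _ => //; [exact: mspan0|exact: mspanD].
Qed.

Lemma mspan_mono (X Y : index -> Prop) v : (forall x, X x -> Y x) -> mspan X v -> mspan Y v.
Proof.
move=> XY; elim=> [u Nu|x /XY Yx|a u w _ Yu _ Yw].
- exact: MspanBase.
- exact: MspanGen.
- exact: MspanLin.
Qed.

Lemma mspan_combination X v : mspan X v -> exists (s : seq index) (c : index -> A),
  [/\ uniq s, forall x, x \in s -> X x & N0 (v - \sum_(x <- s) c x *: e x)].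
Proof.
elim=> [u Nu|x Xx|a u w _ [s [c [us sX Nu]]] _ [r [d [ur rX Nw]]]].
- by exists [::], (fun=> 0); split=> //; rewrite big_nil subr0.
- exists [:: x], (fun=> 1); split=> //; first by move=> y; rewrite inE => /eqP->.
  by rewrite big_seq1 scale1r subrr.
have widen (s1 s2 : seq index) (f : index -> A) : uniq s1 -> uniq s2 ->
    {subset s1 <= s2} ->
    \sum_(x <- s1) f x *: e x = \sum_(x <- s2) (if x \in s1 then f x else 0) *: e x.
  move=> us1 us2 s12; rewrite (perm_big [seq x <- s2 | x \in s1]) /=; last first.
    apply: uniq_perm; rewrite ?filter_uniq // => x; rewrite mem_filter andbC.
    by case xs1: (x \in s1); rewrite ?andbF // s12.
  rewrite big_filter big_mkcond; apply: eq_bigr => x _.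
  by case: ifP; rewrite ?scale0r.
have uU : uniq (undup (s ++ r)) := undup_uniq _.
exists (undup (s ++ r)), (fun x => a * (if x \in s then c x else 0) +
                                  (if x \in r then d x else 0)).
split=> // [x|].
  by rewrite mem_undup mem_cat => /orP[/sX|/rX].
under eq_bigr => x _ do rewrite scalerDl -scalerA.
rewrite big_split /= -scaler_sumr -!widen //; first 1 last.
- by move=> x xr; rewrite mem_undup mem_cat xr orbT.
- by move=> x xs; rewrite mem_undup mem_cat xs.
by rewrite opprD addrACA -scalerBr; exact: N0_closed.
Qed.

Definition pdeg (m : 'X_{1..N}) : nat := \sum_(i | p i) m i.

Lemma pdegD m m' : pdeg (m + m') = (pdeg m + pdeg m')%N.
Proof. by rewrite -big_split; apply: eq_bigr => i _; rewrite mnmDE. Qed.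
Lemma pdeg0 : pdeg 0 = 0%N.
Proof. by apply: big1 => i _; rewrite mnm0E. Qed.
Lemma pdeg1 j : pdeg U_(j) = p j.
Proof.
rewrite /pdeg (eq_bigr (fun i : 'I_N => nat_of_bool (j == i))); last first.
  by move=> i _; rewrite mnm1E.
rewrite big_mkcond (bigD1 j) //= eqxx big1 ?addn0; first by case: (p j).
by move=> i ij; rewrite eq_sym (negbTE ij); case: ifP.
Qed.
Lemma pdeg_le_mdeg m : (pdeg m <= mdeg m)%N.
Proof.
by rewrite mdegE /pdeg big_mkcond /=; apply: leq_sum => i _; case: ifP.
Qed.

(** A variable in [p] weighs [w + 1] and any other variable weighs 1, so a large [w] penalizes the
    variables in [p]. *)
Definition weight w m := (mdeg m + w * pdeg m)%N.

Lemma weightD w m m' : weight w (m + m') = (weight w m + weight w m')%N.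
Proof. by rewrite /weight mdegD pdegD mulnDr addnACA. Qed.

Definition lt_index (x y : index) : Prop :=
  (pdeg x.1 < pdeg y.1)%N \/ pdeg x.1 = pdeg y.1 /\
    ((x.1 < y.1)%O \/ x.1 = y.1 /\ (x.2 < y.2)%N).

(** The order is lexicographic in the degree [pdeg], the monomial and the position, each of which is
    well founded; hence the three nested inductions. *)
Lemma lt_index_ind (P : index -> Prop) :
  (forall x, (forall y, lt_index y x -> P y) -> P x) -> forall x, P x.
Proof.
move=> IH; suff H b : forall m i, pdeg m = b -> P (m, i) by case=> m i; exact: (H _).
elim/ltn_ind: b => b IHb; elim/(@ltmwf N) => m IHm i.
have [l] := ubnP i; elim: l i => // l IHl i il mb.
apply: IH => -[m' i'] [|[]] /=; rewrite mb => lt_b; first exact: IHb lt_b _ _ _.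
case=> [lt_m|[-> lt_i]]; first exact: IHm lt_m _ lt_b.
by apply: IHl mb; apply: leq_trans lt_i _.
Qed.

Lemma lt_index_trans y x z : lt_index x y -> lt_index y z -> lt_index x z.
Proof.
rewrite /lt_index => -[xy|[-> xy]] [yz|[<- yz]]; [left|by left|by left|right].
  exact: ltn_trans xy yz.
split=> //; case: xy yz => [xy|[-> xy]] [yz|[<- yz]]; [left|by left|by left|right].
  exact: Order.POrderTheory.lt_trans xy yz.
by split=> //; exact: ltn_trans xy yz.
Qed.

Lemma lt_index_total x y : [\/ x = y, lt_index x y | lt_index y x].
Proof.
case: x y => [m i] [m' i']; rewrite /lt_index /=.
case: (ltngtP (pdeg m) (pdeg m')) => [?|?|pE]; [by apply: Or32; left|by apply: Or33; left|].
case: (Order.TotalTheory.ltgtP m m') => [?|?|mE];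
  [by apply: Or32; right; split=> //; left|by apply: Or33; right; split=> //; left|].
case: (ltngtP i i') => [?|?|/val_inj->]; last by rewrite mE; apply: Or31.
  by apply: Or32; right; split=> //; right.
by apply: Or33; right; split=> //; right.
Qed.

Definition shift (x : index) (j : 'I_N) : index := ((x.1 + U_(j))%MM, x.2).

Lemma lt_index_shift x y j : lt_index x y -> lt_index (shift x j) (shift y j).
Proof.
rewrite /lt_index /= !pdegD ltn_add2r => -[|[-> xy]]; [by left|right; split=> //].
by case: xy => [xy|[-> ?]]; [left; rewrite ltmc_add2l|right].
Qed.

(** All nonzero multiples of [e x] are tested because the coefficients form a domain that need not
    be a field. *)
Definition standard x := forall a, a != 0 -> ~ mspan (lt_index^~ x) (a *: e x).

(** The largest index with a nonzero coefficient would have a multiple in the span of smaller ones,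
    and so would not be standard. *)
Lemma standard_independent (s : seq index) c : uniq s ->
  (forall x, x \in s -> standard x) -> N0 (\sum_(x <- s) c x *: e x) ->
  forall x, x \in s -> c x = 0.
Proof.
move=> us sS Ns x xs; apply/eqP/negP => /negP cx.
have [y [ys cy ymax]] : exists y, [/\ y \in s, c y != 0 &
    forall z, z \in s -> c z != 0 -> z = y \/ lt_index z y].
  have: exists2 x, x \in s & c x != 0 by exists x.
  elim: s {us sS Ns xs cx x} => [|x s IH] [x0 //].
  have [[y ys cy] _|noy] := pselect (exists2 y, y \in s & c y != 0); last first.
    rewrite inE => /predU1P[-> cx|x0s cx0]; last by case: noy; exists x0.
    exists x; split; rewrite ?mem_head // => z; rewrite inE => /predU1P[->|zs cz].
      by left.
    by case: noy; exists z.
  have [|{cy}y [{}ys cy ymax]] := IH; first by exists y.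
  have keep z : z \in x :: s -> c z != 0 -> (c x != 0 -> lt_index x y) -> z = y \/ lt_index z y.
    by rewrite inE => /predU1P[->|zs] cz xy; [right; exact: xy|exact: ymax].
  have y_xs : y \in x :: s by rewrite inE ys orbT.
  move=> _; case: (eqVneq (c x) 0) => [cx0|cx].
    by exists y; split=> // z zs cz; apply: keep => //; rewrite cx0 eqxx.
  case: (lt_index_total x y) => [xy|xy|yx].
  - by exists y; split=> // z; rewrite inE => /predU1P[->|zs] cz; [left|exact: ymax].
  - by exists y; split=> // z zs cz; exact: keep.
  - exists x; split; rewrite ?mem_head // => z; rewrite inE => /predU1P[->|zs] cz; first by left.
    right; case: (ymax z zs cz) => [->//|zy]; exact: lt_index_trans zy yx.
apply: (sS y ys (c y) cy).
have -> : c y *: e y = \sum_(z <- s) c z *: e z - \sum_(z <- s | z != y) c z *: e z.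
  by rewrite (bigD1_seq y) //= addrK.
apply: mspanB; first exact: MspanBase.
rewrite -big_filter; apply: mspan_sum => z; rewrite mem_filter => /andP[zy zs].
have [->|cz] := eqVneq (c z) 0; first by rewrite scale0r; exact: mspan0.
apply/mspanZ/MspanGen; case: (ymax z zs cz) => // zyE.
by rewrite zyE eqxx in zy.
Qed.

Variables (g : 'I_N -> V -> V) (w0 : nat).
Hypothesis g_linear : forall j, linear (g j).
Hypothesis g_N0 : forall j v, N0 v -> N0 (g j v).
(* [g j] multiplies by the [j]-th generator, up to terms of smaller [pdeg]. *)
Hypothesis g_shift : forall j x,
  mspan (fun y => (pdeg y.1 < pdeg (shift x j).1)%N /\
                 (weight w0 y.1 <= weight w0 (shift x j).1)%N)
       (g j (e x) - e (shift x j)).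

(** Besides its literal use, this serves below as induction on monomials, started at the monomial
    0. *)
Lemma upward_by_shift (L : 'X_{1..N} -> Prop) :
  (forall m j, L m -> L (m + U_(j))%MM) -> upward_closed L.
Proof.
move=> LS m m' mm' Lm; rewrite -(submK mm') addmC.
elim: {m'}(mdeg (m' - m)) {-2}(m' - m)%MM (erefl (mdeg (m' - m))) {mm'} => [|d IH] r rd.
  by move/eqP: rd; rewrite mdeg_eq0 => /eqP->; rewrite addm0.
have [j rj] : exists j, r j != 0%N.
  apply/existsP; rewrite -negb_forall; apply/negP => /forallP r0.
  move: rd; rewrite mdegE big1 // => i _; apply/eqP; exact: r0.
have jr : (U_(j) <= r)%MM by rewrite lep1mP.
rewrite -(submK jr) addmA; apply/LS/IH.
by apply: succn_inj; rewrite -rd -[in RHS](submK jr) mdegD mdeg1 addn1.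
Qed.

Section Reduction.
Variable W : index -> index -> Prop.
Hypothesis W_shift : forall x y j, W y x -> W (shift y j) (shift x j).
Hypothesis W_trans : forall x y z, W z y -> W y x -> W z x.
Hypothesis W_weight : forall x y,
  (pdeg y.1 < pdeg x.1)%N -> (weight w0 y.1 <= weight w0 x.1)%N -> W y x.

(** [W] controls which terms may occur in a reduction: it is trivial when only standardness matters,
    and compares weights when the reduction must be uniform. *)
Definition reducible a x := mspan (fun y => lt_index y x /\ W y x) (a *: e x).

(** Applying [g j] to a relation shifts all its indices, which preserves their order; the correction
    terms have smaller [pdeg] than the shifted index that they come with, so they stay below
    [shift x j]. *)
Lemma reducible_shift a x j : reducible a x -> reducible a (shift x j).
Proof.
move=> ax.
pose X' y := lt_index y (shift x j) /\ W y (shift x j).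
have gspan v : mspan (fun y => lt_index y x /\ W y x) v -> mspan X' (g j v).
  elim=> [u Nu|y [yx Wyx]|b u w _ Yu _ Yw]; first by apply: MspanBase; exact: g_N0.
    rewrite -[g j _](subrK (e (shift y j))); apply: mspanD; last first.
      by apply: MspanGen; split; [exact: lt_index_shift|exact: W_shift].
    apply: mspan_mono (g_shift j y) => z [pz wz]; split.
      apply: lt_index_trans (lt_index_shift j yx); by left.
    exact: W_trans (W_weight pz wz) (W_shift j Wyx).
  by rewrite g_linear; exact: MspanLin.
have gZ : g j (a *: e x) = a *: g j (e x).
  have g0 : g j 0 = 0 by have := g_linear j (-1) 0 0; rewrite scaler0 addr0 scaleN1r addNr.
  by rewrite -[a *: _]addr0 g_linear g0 addr0.
rewrite /reducible.
have -> : a *: e (shift x j) = g j (a *: e x) - a *: (g j (e x) - e (shift x j)).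
  by rewrite gZ scalerBr opprB addrC subrK.
apply: mspanB; first exact: gspan.
apply: mspanZ; apply: mspan_mono (g_shift j x) => z [pz wz]; split; first by left.
exact: W_weight.
Qed.

End Reduction.

Lemma nonstandardP x : ~ standard x <->
  exists2 a, a != 0 & reducible (fun _ _ => True) a x.
Proof.
split=> [|[a a0 ax] /(_ a a0)]; last by apply; apply: mspan_mono ax => y [].
move=> nS; apply: contrapT => nex; apply: nS => a a0 ax; apply: nex.
by exists a => //; apply: mspan_mono ax => y; split.
Qed.

Lemma nonstandard_upward i : upward_closed (fun m => ~ standard (m, i)).
Proof.
apply: upward_by_shift => m j /nonstandardP[a a0 ax]; apply/nonstandardP.
by exists a => //; apply: reducible_shift ax.
Qed.

(** A term [y] of smaller [pdeg] than [x] weighs no more than [x] once [w'] is at least [mdeg y.1].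
    A smaller term of equal [pdeg] has no larger total degree, so it is harmless for every
    weight. *)
Lemma heavy_enough x v : mspan (lt_index^~ x) v -> exists w, forall w', (w <= w')%N ->
  mspan (fun y => lt_index y x /\ (weight w' y.1 <= weight w' x.1)%N) v.
Proof.
elim=> [u Nu|y yx|a u1 u2 _ [w1 h1] _ [w2 h2]].
- by exists 0%N => w' _; exact: MspanBase.
- exists (mdeg y.1) => w' w'y; apply: MspanGen; split=> //.
  case: yx; rewrite /weight; first by nia.
  case=> -> h; rewrite leq_add2r; case: h => [h|[-> //]].
  exact/lemc_mdeg/Order.POrderTheory.ltW.
- exists (maxn w1 w2) => w'; rewrite geq_max => /andP[w1w' w2w'].
  by apply: MspanLin; [exact: h1|exact: h2].
Qed.

(** By Dickson's lemma the nonstandard indices are the multiples of finitely many. The product of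
    the multipliers of these generators and the maximum of their weights work for all generators,
    and shifting carries the reductions to all multiples. *)
Lemma uniform_reduction : exists w B, [/\ (w0 <= w)%N, B != 0 & forall x, ~ standard x ->
  reducible (fun y x => (weight w y.1 <= weight w x.1)%N) B x].
Proof.
have [gens gensP] := choice (fun i => dickson (@nonstandard_upward i)).
pose xs := [seq (m, i) | i <- enum 'I_q, m <- gens i].
have xs_std x : x \in xs -> ~ standard x.
  case/allpairsPdep=> i [m [_ mi ->]]; apply/(gensP i m).
  by exists m; rewrite ?lepm_refl.
have [w [B [w0w B0 wB]]] : exists w B, [/\ (w0 <= w)%N, B != 0 &
    forall w' x, (w <= w')%N -> x \in xs ->
      reducible (fun y x => (weight w' y.1 <= weight w' x.1)%N) B x].
  elim: xs xs_std => [_|x xs IH xs_std]; first by exists w0, 1; rewrite oner_neq0.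
  have [|w1 [B1 [w01 B10 wB1]]] := IH.
    by move=> y ys; apply: xs_std; rewrite inE ys orbT.
  have /nonstandardP[a a0 ax] := xs_std x (mem_head _ _).
  have [|w2 h2] := @heavy_enough x (a *: e x).
    by apply: mspan_mono ax => y [].
  exists (maxn w1 w2), (B1 * a); split=> [||w' y].
  - by rewrite leq_max w01.
  - by rewrite mulf_neq0.
  rewrite geq_max inE => /andP[w1w' w2w'] /predU1P[->|ys]; rewrite /reducible.
    by rewrite -scalerA; apply/mspanZ/h2.
  by rewrite mulrC -scalerA; apply: mspanZ; exact: wB1.
exists w, B; split=> // -[m i] /(gensP i)[m' m'i m'm].
have up : upward_closed (fun m =>
    reducible (fun y x => (weight w y.1 <= weight w x.1)%N) B (m, i)).
  apply: upward_by_shift => {m'm}m j; apply: reducible_shift => [x y j'|x y z|x y]; rewrite /= ?weightD.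
  - by rewrite leq_add2r.
  - exact: leq_trans.
  - by move: w0w; rewrite /weight; nia.
apply: (up m' m m'm); apply: wB => //.
by apply/allpairsPdep; exists i, m'; rewrite mem_enum.
Qed.

(** Well-founded induction along the order: each reduction step costs one factor [B] and never
    increases the weight. *)
Theorem standard_reduction : exists w B, B != 0 /\ forall x, exists t,
  mspan (fun y => standard y /\ (weight w y.1 <= weight w x.1)%N) (B ^+ t *: e x).
Proof.
have [w [B [w0w B0 red]]] := uniform_reduction; exists w, B; split=> //.
elim/lt_index_ind => x IH; have [sx|/red nsx] := pselect (standard x).
  by exists 0%N; rewrite expr0 scale1r; apply: MspanGen.
have [t tB] : exists t,
    mspan (fun y => standard y /\ (weight w y.1 <= weight w x.1)%N) (B ^+ t *: (B *: e x)).
  elim: nsx => [v Nv|y [yx wyx]|a u v _ [t1 h1] _ [t2 h2]].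
  - exists 0%N; rewrite expr0 scale1r; exact: MspanBase.
  - have [t h] := IH y yx; exists t; apply: mspan_mono h => z [sz wz]; split=> //.
    exact: leq_trans wz wyx.
  exists (t1 + t2)%N; rewrite scalerDr exprD; apply: mspanD.
    by rewrite scalerA mulrC mulrA mulrAC -scalerA; apply: mspanZ.
  by rewrite -scalerA; apply: mspanZ.
by exists t.+1; rewrite exprSr -scalerA.
Qed.

End StandardMonomials.

(** * Chains of primes *)

Section PrimeAvoidingMonoid.
Variables (S : comNzRingType) (I Sigma : S -> Prop).
Hypotheses (I0 : I 0) (I_closed : forall a u v, I u -> I v -> I (a * u + v)).
Hypotheses (Sigma1 : Sigma 1) (SigmaM : forall a b, Sigma a -> Sigma b -> Sigma (a * b)).
Hypothesis I_Sigma : forall x, I x -> ~ Sigma x.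

(** An ideal that is maximal among those containing [I] and disjoint from the multiplicative set
    [Sigma] is prime. *)
Lemma exists_prime : exists P : {pred S},
  [/\ spec_point P, forall x, I x -> x \in P & forall x, x \in P -> ~ Sigma x].
Proof.
pose good (X : set S) := [/\ forall x, I x -> X x,
  forall a u v, X u -> X v -> X (a * u + v) & forall x, X x -> ~ Sigma x].
have [F Fgood Ftot|M [Mgood Mmax]] :=
    @Zorn_bigcup S (fun X => X = (fun=> False) \/ good X).
  have [[X FX gX]|nog] := pselect (exists2 X, F X & good X); last first.
    left; rewrite predeqE => x; split=> // -[X FX Xx].
    by have [X0|gX] := Fgood X FX; [rewrite X0 in Xx|case: nog; exists X].
  right; split.
  - by move=> x Ix; exists X => //; case: gX => IX _ _; exact: IX.
  - move=> a u v [U FU Uu] [W FW Wv].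
    have gU : good U by have [U0|//] := Fgood U FU; rewrite U0 in Uu.
    have gW : good W by have [W0|//] := Fgood W FW; rewrite W0 in Wv.
    have [UW|WU] := Ftot U W FU FW.
      by exists W => //; case: gW => _ cW _; apply: cW => //; exact: UW.
    by exists U => //; case: gU => _ cU _; apply: cU => //; exact: WU.
  - by move=> x [Y FY Yx]; have [Y0|[_ _]] := Fgood Y FY; [rewrite Y0 in Yx|apply].
have gI : good I by split.
have {Mgood}[IM cM dM] : good M.
  case: Mgood => // M0; exfalso; apply: (Mmax I); last by right.
  by rewrite M0; split=> // /(_ 0 I0).
have M0 : M 0 by apply: IM.
(* [ext u] is the ideal [M + S u]; by maximality it meets [Sigma] as soon as [u] is not in [M]. *)
pose ext u x := exists s, M (x - s * u).
have gext u : ~ M u -> exists2 x, ext u x & Sigma x.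
  move=> nMu; apply: contrapT => nx; apply: (Mmax (ext u)).
    split=> [x Mx|sub]; first by exists 0; rewrite mul0r subr0.
    by apply: nMu; apply: sub; exists 1; rewrite mul1r subrr.
  right; split.
  - by move=> x Ix; exists 0; rewrite mul0r subr0; apply: IM.
  - move=> a x y [s Ms] [t Mt]; exists (a * s + t).
    have -> : a * x + y - (a * s + t) * u = a * (x - s * u) + (y - t * u).
      by rewrite mulrBr mulrDl mulrA opprD addrACA.
    exact: cM.
  - by move=> x xu Sx; apply: nx; exists x.
have inM x : (x \in (fun y => `[< M y >] : bool)) = `[< M x >] by [].
exists (fun x => `[< M x >]); split; first split.
- split.
  + by rewrite inM; apply/asboolP.
  + by apply/negP; rewrite inM => /asboolP/dM; apply.
  + by move=> a u v; rewrite !inM => /asboolP Mu /asboolP Mv; apply/asboolP/cM.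
- move=> u v; rewrite !inM => /asboolP Muv; apply/orP.
  have [Mu|nMu] := pselect (M u); first by left; exact/asboolP.
  have [Mv|nMv] := pselect (M v); first by right; exact/asboolP.
  have [x [s Mx] Sx] := gext u nMu; have [y [t My] Sy] := gext v nMv.
  case: (dM (x * y) _ (SigmaM Sx Sy)).
  (* Modulo [M], [x] is [s * u] and [y] is [t * v], so [x * y] is a multiple of [u * v]. *)
  have -> : x * y = y * (x - s * u) + (s * u * (y - t * v) + (s * t * (u * v) + 0)).
    rewrite !mulrBr addr0 [s * t * _]mulrACA subrK [s * u * y]mulrC subrK.
    exact: mulrC.
  by apply: (cM) => //; apply: (cM) => //; apply: cM.
- by move=> x Ix; rewrite inM; apply/asboolP/IM.
- by move=> x; rewrite inM => /asboolP/dM.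
Qed.

End PrimeAvoidingMonoid.

Section PrimeChains.
Variables (k : idomainType) (S : comNzRingType) (N : nat) (z : 'I_N -> S).

(** Spanning by the monomials in [z] over [k], in the form of an induction principle. *)
Definition generates (iota : k -> S) := forall Q : S -> Prop,
  (forall m, Q (mmap1 z m)) -> Q 0 ->
  (forall c u v, Q u -> Q v -> Q (iota c * u + v)) -> forall s, Q s.

Definition ideal (I : S -> Prop) := I 0 /\ forall a u v, I u -> I v -> I (a * u + v).

Lemma mmap1_U m j : mmap1 z (m + U_(j)) = z j * mmap1 z m.
Proof.
rewrite commr_mmap1_M ?mmap1U 1?mulrC // => i x; exact: mulrC.
Qed.

(* Generic freeness: up to powers of [B], [S / I] is free over [{poly A0}] on the
   standard monomials, one of which is [1], so any [lambda] that is not a root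
   of [B] works. *)
Lemma specialization (A0 : idomainType) (rho : {rmorphism {poly A0} -> S})
    (kappa : k -> A0) (I : S -> Prop) :
  (forall n, n.+1%:R != 0 :> A0) -> generates (fun c => rho (kappa c)%:P) ->
  ideal I -> (forall a, I (rho a) -> a = 0) ->
  exists lambda : A0, forall a s, I (rho a%:P - rho ('X - lambda%:P) * s) -> a = 0.
Proof.
move=> char0 gen [I0 Icl] inj.
pose V : lmodType {poly A0} := restr rho (S^o : lmodType S).
pose J : V -> Prop := I.
pose e (x : 'X_{1..N} * 'I_1) : V := mmap1 z x.1.
pose g j (v : V) : V := z j * (v : S).
have scaleE a (v : V) : a *: v = rho a * (v : S) by [].
have glin j : linear (g j).
  by move=> a u v; rewrite /g !scaleE mulrDr mulrCA.
have Icl' (a : {poly A0}) (u v : V) : J u -> J v -> J (a *: u + v) by exact: Icl.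
have gN0 j v : I v -> I (g j v) by move=> Iv; rewrite -[g j v]addr0; apply: Icl.
(* Multiplying a monomial by [z j] gives exactly the next monomial, so there are no correction terms
   and the empty predicate [pred0] suffices for [pdeg]. *)
have [|w [B [B0 red]]] := @standard_reduction _ V J I0 N 1 pred0 e g 0 glin gN0.
  by move=> j x; rewrite /g /e /= mmap1_U subrr; apply: MspanBase.
(* In characteristic zero the natural numbers are distinct constants, and [B] has fewer than
   [size B] roots. *)
have [n Bn] : exists n : nat, B.[n%:R] != 0.
  apply: contrapT => noroot.
  have lt_neq i j : (i < j)%N -> i%:R != j%:R :> A0.
    move=> ij; rewrite eq_sym -subr_eq0 -natrB ?(ltnW ij) //.
    by rewrite -(@prednK (j - i)) ?subn_gt0.
  have rB : all (root B) [seq n%:R | n <- iota 0 (size B)].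
    apply/allP => _ /mapP[n _ ->]; rewrite rootE; apply/negPn/negP => Bn.
    by apply: noroot; exists n.
  have := max_poly_roots B0 rB; rewrite size_map size_iota ltnn.
  rewrite map_inj_uniq ?iota_uniq; first by move=> /(_ isT).
  move=> i j ij; case: (ltngtP i j) => // /lt_neq; rewrite ij eqxx //.
exists n%:R => a s Is.
have [t [r [c [ur rstd Ir]]]] : exists t (r : seq ('X_{1..N} * 'I_1)) (c : _ -> {poly A0}),
    [/\ uniq r, forall x, x \in r -> standard J pred0 e x
      & J ((B ^+ t *: (s : V)) - \sum_(x <- r) c x *: e x)].
  suff [t st] : exists t, mspan J e (standard J pred0 e) (B ^+ t *: (s : V)).
    by exists t; exact: (mspan_combination Icl' I0).
  move: s {Is}; apply: gen => [m||b u v [t1 h1] [t2 h2]].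
  - have [t st] := red (m, ord0); exists t; apply: mspan_mono st => x [] //.
  - by exists 0%N; rewrite scaler0; apply: MspanBase.
  exists (t1 + t2)%N; rewrite exprD.
  have -> : (B ^+ t1 * B ^+ t2) *: ((rho (kappa b)%:P * u + v) : V) =
      ((kappa b)%:P * B ^+ t2) *: (B ^+ t1 *: (u : V)) + B ^+ t1 *: (B ^+ t2 *: (v : V)).
    rewrite !scalerA -[rho _ * u]/((kappa b)%:P *: (u : V)) scalerDr scalerA.
    by congr (_ *: _ + _); rewrite mulrC mulrA mulrAC.
  by apply: MspanLin => //; apply: mspanZ.
pose x0 : 'X_{1..N} * 'I_1 := (0%MM, ord0).
have ex0 : e x0 = 1 :> S by rewrite /e mmap11.
(* No index lies below that of the monomial 1, so a multiple [b] of 1 in the span would lie in [I],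
   whence [b = 0] by injectivity. *)
have std0 : standard J pred0 e x0.
  move=> b b0 sb; have : I (b *: e x0).
    elim: sb => // [x|b' u v _ Iu _ Iv]; last exact: Icl.
    rewrite /lt_index pdeg0 ltn0 => -[//|[_ []]] /=; last by case.
    by rewrite Order.TotalTheory.ltNge le0m.
  by rewrite scaleE ex0 mulr1 => /inj bE; rewrite bE eqxx in b0.
(* The coefficients on standard monomials, modulo [I], of [B ^+ t] times the element of [I] given by
   [Is]; they vanish by independence. *)
pose d x := (if x == x0 then B ^+ t * a%:P else 0) -
  ('X - (n%:R)%:P) * (if x \in r then c x else 0).
pose r' := undup (x0 :: r).
have d0 : d x0 = 0.
  apply: (@standard_independent _ V J I0 N 1 pred0 e r' d).
  - exact: undup_uniq.
  - by move=> x; rewrite mem_undup inE => /predU1P[->|/rstd].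
  - have -> : \sum_(x <- r') d x *: e x = (B ^+ t * a%:P) *: e x0 -
        ('X - (n%:R)%:P) *: \sum_(x <- r) c x *: e x.
      under eq_bigr => x _ do rewrite scalerBl.
      rewrite sumrB; congr (_ - _).
        rewrite (bigD1_seq x0) ?undup_uniq ?mem_undup ?mem_head //= eqxx big1 ?addr0 //.
        by move=> x /negbTE->; rewrite scale0r.
      rewrite scaler_sumr.
      rewrite [RHS](perm_big [seq x <- r' | x \in r]) /=; last first.
        apply: uniq_perm => //; first by rewrite filter_uniq ?undup_uniq.
        by move=> x; rewrite mem_filter mem_undup inE; case: (x \in r); rewrite ?orbT.
      rewrite [RHS]big_filter [RHS]big_mkcond; apply: eq_bigr => x _.
      by case: ifP => _; rewrite ?mulr0 ?scale0r ?scalerA.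
    have -> : (B ^+ t * a%:P) *: e x0 - ('X - (n%:R)%:P) *: \sum_(x <- r) c x *: e x =
        B ^+ t *: ((rho a%:P - rho ('X - (n%:R)%:P) * s) : V) +
        (('X - (n%:R)%:P) *: ((B ^+ t *: (s : V)) - \sum_(x <- r) c x *: e x) + 0) :> V.
      rewrite addr0 [X in _ = _ + X]scalerBr addrA; congr (_ - _).
      rewrite [X in X + _]scalerBr -addrA.
      have -> : - (B ^+ t *: (rho ('X - n%:R%:P) * s : V)) +
                ('X - n%:R%:P) *: (B ^+ t *: (s : V)) = 0 :> V.
        rewrite -[rho _ * s]/(('X - n%:R%:P) *: (s : V)) !scalerA mulrC addrC subrr //.
      by rewrite addr0 -scalerA; congr (_ *: _); rewrite scaleE ex0 mulr1.
    by apply: (Icl') => //; apply: Icl'.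
  - by rewrite mem_undup mem_head.
(* Evaluation at the chosen constant kills the multiple of ['X - n], leaving [a] times a power of
   the nonzero value of [B]. *)
move: d0 => /(congr1 (horner^~ n%:R)); rewrite /d eqxx !hornerE subrr mul0r subr0.
move=> /eqP; rewrite mulf_eq0 expf_eq0 (negbTE Bn) andbF /=.
by move/eqP.
Qed.

(** The polynomial ring in [e] variables, built one variable at a time so that the outermost one can
    be specialized. *)
Fixpoint tower (e : nat) : idomainType := if e is e'.+1 then {poly (tower e')} else k.

Fixpoint tower_const (e : nat) : k -> tower e :=
  if e is e'.+1 then fun c => (tower_const e' c)%:P else id.

Lemma tower_char0 e : (forall n, n.+1%:R != 0 :> k) -> forall n, n.+1%:R != 0 :> tower e.
Proof.
move=> char0; elim: e => [|e IH] n /=; first exact: char0.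
by rewrite -polyC_natr polyC_eq0.
Qed.

(** A prime [P0] that contains [I] and meets the image of the tower only in 0 starts the chain.
    Specializing the outermost variable keeps the smaller tower injective modulo [P0] and the new
    relation, and the induction continues from that ideal. *)
Theorem prime_chain (char0 : forall n, n.+1%:R != 0 :> k) e
    (rho : {rmorphism tower e -> S}) (I : S -> Prop) :
  generates (fun c => rho (tower_const e c)) ->
  ideal I -> (forall a, I (rho a) -> a = 0) ->
  exists P : nat -> {pred S},
    (forall i, (i <= e)%N -> spec_point (P i) /\ forall x, I x -> x \in P i) /\
    (forall i, (i < e)%N ->
       {subset P i <= P i.+1} /\ exists a, a \in P i.+1 /\ a \notin P i).
Proof.
elim: e rho I => [|e IH] rho I gen [I0 Icl] inj.
  have [||x Ix [a a0 xE]|P [Pspec IP _]] := @exists_prime S I (fun x => exists2 a, a != 0 & x = rho a) I0 Icl.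
  - by exists 1; rewrite ?oner_neq0 ?rmorph1.
  - move=> _ _ [a a0 ->] [b b0 ->]; exists (a * b); rewrite ?rmorphM //.
    exact: mulf_neq0.
  - by move: a0; rewrite (inj a) ?eqxx -?xE.
  by exists (fun=> P); split.
have [||x Ix [a a0 xE]|P0 [Pspec IP dP]] := @exists_prime S I (fun x => exists2 a, a != 0 & x = rho a) I0 Icl.
- by exists 1; rewrite ?oner_neq0 ?rmorph1.
- move=> _ _ [a a0 ->] [b b0 ->]; exists (a * b); rewrite ?rmorphM //.
  exact: mulf_neq0.
- by move: a0; rewrite (inj a) ?eqxx -?xE.
have [[P00 P01 Pcl] _] := Pspec.
have Pinj a : rho a \in P0 -> a = 0.
  by move=> Pa; apply/eqP/negP => /negP a0; apply: (dP _ Pa); exists a.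
have [|||lambda Hl] := @specialization (tower e) rho (tower_const e) (fun x => x \in P0) (tower_char0 e char0).
- exact: gen.
- by split=> // a u v; exact: Pcl.
- exact: Pinj.
set y := rho ('X - lambda%:P) in Hl.
(* The next ideal is [P0 + y S]; the injectivity of the remaining tower modulo it is [Hl]. *)
have [||a [s]|P [Pi Pinc]] := IH (rho \o polyC) (fun x => exists s, x - y * s \in P0).
- exact: gen.
- split; first by exists 0; rewrite mulr0 subr0.
  move=> a u v [s Ps] [t Pt]; exists (a * s + t).
  have -> : a * u + v - y * (a * s + t) = a * (u - y * s) + (v - y * t).
    by rewrite mulrBr mulrDr opprD addrACA mulrCA.
  exact: Pcl.
- exact: Hl.
exists (fun i => if i is j.+1 then P j else P0); split=> -[|i] //= ie.
- have [sP xP] := Pi i ie; split=> // x Ix; apply: xP; exists 0.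
  by rewrite mulr0 subr0; exact: IP.
- have [_ xP] := Pi 0%N isT; split=> [x xP0|].
    by apply: xP; exists 0; rewrite mulr0 subr0.
  exists y; split; first by apply: xP; exists 1; rewrite mulr1 subrr.
  by apply/negP => /Pinj/eqP; rewrite polyXsubC_eq0.
- exact: Pinc.
Qed.

End PrimeChains.

(** * Homogeneous elements of the associated graded ring and module *)

Section HomogeneousClasses.
Variables (R : nzRingType) (F : ring_filt R).

(* [0] unless [a] has order at most [p]. *)
Definition hrees p (a : R) : rees F := insubd 0 (a *: 'X^p).

Lemma hreesE p a : F p a -> rees_val (hrees p a) = a *: 'X^p.
Proof.
move=> Fa; apply: insubdK; apply/reesP => i.
rewrite coefZ coefXn; case: eqP => [->|_]; rewrite ?mulr1 ?mulr0 //.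
exact: rfilt0.
Qed.

Lemma rees_inj (x y : rees F) : rees_val x = rees_val y -> x = y.
Proof. by move=> xy; apply: val_inj. Qed.

Definition gcls p a : gr F := gr_class (hrees p a).

Lemma gcls_one : gcls 0 1 = 1.
Proof.
rewrite /gcls -[RHS]/(gr_class 1); congr gr_class; apply: rees_inj.
by rewrite hreesE ?scale1r ?expr0 ?rees_val1 //; exact: rfilt1.
Qed.

Lemma gclsB p a b : F p a -> F p b -> gcls p (a - b) = gcls p a - gcls p b.
Proof.
move=> Fa Fb; rewrite /gcls -gr_classB; congr gr_class; apply: rees_inj.
by rewrite rees_valB !hreesE ?scalerBl //; exact: rfiltB.
Qed.

Lemma gclsD p a b : F p a -> F p b -> gcls p (a + b) = gcls p a + gcls p b.
Proof.
move=> Fa Fb; rewrite /gcls -gr_classD; congr gr_class; apply: rees_inj.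
by rewrite rees_valD !hreesE ?scalerDl //; exact: rfiltD.
Qed.

Lemma gclsM p q a b : F p a -> F q b -> gcls p a * gcls q b = gcls (p + q) (a * b).
Proof.
move=> Fa Fb; rewrite /gcls [LHS]gr_classM; congr gr_class; apply: rees_inj.
rewrite rees_valM !hreesE //; last exact: rfiltM.
rewrite -!mul_polyC polyCM exprD -!mulrA; congr (_ * _).
by rewrite !mulrA; congr (_ * _); exact/esym/commr_polyXn.
Qed.

Lemma gcls_eq0 p a : rfilt_pred F p a -> gcls p a = 0.
Proof.
move=> Fpa; have Fa : F p a.
  by case: p Fpa => [/= ->|p]; [exact: rfilt0|exact: rfiltS].
have <- : gr_class (0 : rees F) = 0 by rewrite /gr_class raddf0.
apply/gr_classP; rewrite subr0; apply/rees_shiftP => i.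
rewrite hreesE // coefZ coefXn; case: eqP => [->|_]; rewrite ?mulr1 ?mulr0 //.
exact: rfilt_pred0.
Qed.

Lemma gcls_ind (Q : gr F -> Prop) : Q 0 -> (forall a b, Q a -> Q b -> Q (a + b)) ->
  (forall p a, F p a -> Q (gcls p a)) -> forall x, Q x.
Proof.
move=> Q0 QD Qc x; rewrite -[x]gr_reprK; move: (gr_repr x) => f {x}.
have -> : f = \sum_(i < size (rees_val f)) hrees i (rees_val f)`_i.
  apply: rees_inj; rewrite [RHS](raddf_sum val) /= -[LHS]coefK poly_def.
  by apply: eq_bigr => i _; rewrite hreesE //; exact: reesE.
rewrite /gr_class raddf_sum; elim/big_ind: _ => // i _.
by apply: Qc; exact: reesE.
Qed.

Variables (N : lmodType R) (G : mod_filt F N).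

(* [0] unless [v] lies in [G j]. *)
Definition hmrees (j : int) (v : N) : mrees G :=
  insubd 0 (fun i : int => if i == j then v else 0).

Lemma hmreesE j v : G j v -> hmrees j v =1 fun i => if i == j then v else 0.
Proof.
move=> Gv i; rewrite /hmrees -[mrees_val _]/(val _) insubdK //; apply/mreesP; split.
  by exists `|j|%N => i' ji'; case: eqP ji' => // ->; rewrite ltnn.
by move=> i'; case: eqP => [->//|_]; exact: mfilt0.
Qed.

Definition mcls j v : gr_mod G := grm_class (hmrees j v).


Lemma mclsD j u v : G j u -> G j v -> mcls j (u + v) = mcls j u + mcls j v.
Proof.
move=> Gu Gv; rewrite /mcls -grm_classD; congr grm_class; apply: mrees_eq => i.
change (hmrees j (u + v) i = hmrees j u i + hmrees j v i).
by rewrite !hmreesE //; [case: eqP; rewrite ?addr0|exact: mfiltD].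
Qed.

Lemma mcls_act p a j v : F p a -> G j v -> gcls p a *: mcls j v = mcls (p%:Z + j) (a *: v).
Proof.
move=> Fa Gv; rewrite /gcls /mcls [LHS]gr_scaleE; congr grm_class; apply: mrees_eq => i.
rewrite hmreesE; last exact: mfiltZ.
rewrite /= hreesE // -mul_polyC poly_actC.
have -> : forall (q : nat) (h : int -> N) i, poly_act 'X^q h i = h (i - q%:Z).
  move=> q h; elim: q => [|q IH] i'; first by rewrite expr0 poly_act1 subr0.
  by rewrite exprSr poly_actX IH; congr h; lia.
rewrite hmreesE // subr_eq addrC; case: eqP => _ //; exact: scaler0.
Qed.

Lemma mcls_eq0 j v : G j v -> mcls j v = 0 <-> G (j - 1) v.
Proof.
move=> Gv; have <- : grm_class (0 : mrees G) = 0 by rewrite /grm_class raddf0.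
split=> [/grm_classP|Gv'].
  by rewrite subr0 => /mrees_shiftP/(_ j); rewrite hmreesE // eqxx.
apply/grm_classP; rewrite subr0; apply/mrees_shiftP => i; rewrite hmreesE //.
by case: eqP => [->//|_]; exact: mfilt0.
Qed.

Lemma mrees_val_sum (I : Type) (r : seq I) (H : I -> mrees G) j :
  mrees_val (\sum_(i <- r) H i) j = \sum_(i <- r) mrees_val (H i) j.
Proof. exact: (big_morph (fun f : mrees G => mrees_val f j)). Qed.

(** A relation between homogeneous classes can be read off in each degree [l] separately. *)
Lemma mcls_sum_eq0 (I : eqType) (r : seq I) (j : I -> int) (v : I -> N) (l : int) :
  (forall i, i \in r -> G (j i) (v i)) -> \sum_(i <- r) mcls (j i) (v i) = 0 ->
  G (l - 1) (\sum_(i <- r | j i == l) v i).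
Proof.
move=> Gv; rewrite /mcls -raddf_sum => sum0.
have {sum0} : \sum_(i <- r) hmrees (j i) (v i) \in @mrees_shift R F N G.
  rewrite -[X in X \in _]subr0; apply/grm_classP.
  by rewrite [LHS]sum0 /grm_class raddf0.
move=> /mrees_shiftP/(_ l).
rewrite mrees_val_sum.
rewrite [in X in _ -> X]big_mkcond /=.
rewrite (eq_big_seq (fun i => if j i == l then v i else 0)) // => i ir.
by rewrite hmreesE; [rewrite eq_sym|exact: Gv].
Qed.

Lemma mcls_ind (Q : gr_mod G -> Prop) : Q 0 -> (forall a b, Q a -> Q b -> Q (a + b)) ->
  (forall j v, G j v -> Q (mcls j v)) -> forall x, Q x.
Proof.
move=> Q0 QD Qc x; rewrite -[x]grm_reprK; move: (grm_repr x) => f {x}.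
have [b fb] := mrees_supp f.
have -> : f = \sum_(i < (2 * b).+1) hmrees (i%:Z - b%:Z) (f (i%:Z - b%:Z)).
  apply: mrees_eq => j.
  rewrite mrees_val_sum.
  have fE i : hmrees i (f i) j = if j == i then f i else 0.
    exact: hmreesE (mreesE f i) j.
  under eq_bigr do rewrite fE.
  have [jb|jb] := leqP `|j| b; last first.
    rewrite fb // big1 // => i _; case: eqP => // jE; rewrite -jE fb //.
  have lt_i : (absz (j + b%:Z)%R < (2 * b).+1)%N by lia.
  rewrite (bigD1 (Ordinal lt_i)) //= big1 ?addr0.
    by rewrite ifT; [congr (f _); lia|lia].
  move=> i; rewrite -(inj_eq val_inj) /= => ij; case: eqP => // jE.
  by case/eqP: ij; lia.
rewrite /grm_class raddf_sum; elim/big_ind: _ => // i _.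
by apply: Qc; exact: mreesE.
Qed.

End HomogeneousClasses.

(** * Growth bounds the length of chains of primes *)

Lemma mfilt_mono (R : nzRingType) (F : ring_filt R) (N : lmodType R) (G : mod_filt F N)
  (i j : int) u : (i <= j)%R -> G i u -> G j u.
Proof.
move=> ij Gu; have [t ->] : exists t : nat, j = i + t%:Z by exists `|j - i|%N; lia.
elim: t => [|t IH]; first by rewrite addr0.
have -> : i + t.+1%:Z = i + t%:Z + 1 by lia.
exact: mfiltS.
Qed.

Section ReesDependence.
Variables (k : fieldType) (R : nzRingType) (F : ring_filt R) (kappa : {rmorphism k -> R}).
Hypothesis kappaF : forall c, F 0%N (kappa c).
Variables (N : lmodType R) (G : mod_filt F N) (U : lmodType k) (h : {additive N -> U}).
Hypotheses (h_inj : injective h) (h_kappa : forall c v, h (kappa c *: v) = c *: h v).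

(* A relation over [k[t]] between the [f l], divided by the largest possible
   power of [t], has a constant term which is a nontrivial relation modulo
   the shifted filtration. *)
Lemma rees_dependence (L K : nat) (f : 'I_L -> mrees G) (b : 'I_K -> U) : (K < L)%N ->
  (forall l j, exists c : 'I_K -> k, h (f l j) = \sum_i c i *: b i) ->
  exists c : 'I_L -> k, (exists l, c l != 0) /\
    forall j, G (j - 1) (\sum_l kappa (c l) *: f l j).
Proof.
move=> KL fb.
have [B fB] : exists B : nat, forall l j, (B < absz j)%N -> f l j = 0.
  have [B0 fB0] := choice (fun l => mrees_supp (f l)).
  exists (\max_l B0 l) => l j Bj; apply: fB0; apply: leq_ltn_trans Bj.
  exact: (@leq_bigmax _ B0 l).
have [x xP] : exists x : 'I_L -> int -> 'I_K -> k,
    (forall l j, h (f l j) = \sum_i x l j i *: b i) /\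
    (forall l j i, (B < absz j)%N -> x l j i = 0).
  have [x xP] := choice (fun lj : 'I_L * int => fb lj.1 lj.2).
  exists (fun l j i => if (absz j <= B)%N then x (l, j) i else 0); split=> [l j|l j i].
    case: leqP => [_|Bj]; first exact: (xP (l, j)).
    by rewrite fB // raddf0 big1 // => i _; rewrite scale0r.
  by rewrite ltnNge => /negbTE->.
case: xP => hx x0.
(* Row [l] holds the coordinates of [f l] as polynomials in [t], multiplied by [t ^ B] to clear
   negative degrees. The columns from [K] on are zero, so the square matrix is singular. *)
pose X : 'M[{poly k}]_L := \matrix_(l, i)
  if insub (i : nat) is Some i' then \poly_(t < (2 * B).+1) x l (t%:Z - B%:Z) i' else 0.
have Xcoef l (i : 'I_K) t : (X l (widen_ord (ltnW KL) i))`_t = x l (t%:Z - B%:Z) i.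
  rewrite mxE /= insubT // => lti; rewrite coef_poly.
  have -> : Sub (i : nat) lti = i by apply: val_inj.
  by case: ltnP => // Bt; rewrite x0 //; lia.
have : \det X == 0.
  rewrite -det_tr; apply/det0P; exists (delta_mx 0 (Ordinal KL)).
    by apply/eqP => /matrixP/(_ 0 (Ordinal KL))/eqP; rewrite !mxE !eqxx oner_eq0.
  rewrite -rowE; apply/matrixP => i j; rewrite !mxE.
  by case: insubP => // u; rewrite /= ltnn.
case/det0P => v v0 vX.
have exs : exists s, [exists l, (v 0 l)`_s != 0].
  have [l vl] : exists l, v 0 l != 0.
    apply: contrapT => nl; case/eqP: v0; apply/matrixP => i l; rewrite ord1 mxE.
    by apply/eqP/negP => /negP vl; apply: nl; exists l.
  by exists (size (v 0 l)).-1; apply/existsP; exists l; rewrite -lead_coefE lead_coef_eq0.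
(* [t ^ s] is the largest power of [t] dividing the relation [v]. *)
case: (ex_minnP exs) => s /existsP[l0 vs] smin.
have vlt l a : (a < s)%N -> (v 0 l)`_a = 0.
  move=> lt_as; apply/eqP/negP => /negP va; have := smin a.
  by rewrite leqNgt lt_as => H; suff: false by []; apply: H; apply/existsP; exists l.
(* A common range of summation, beyond the sizes of all [v 0 l], the exponent [s] and the index
   [j + B]. *)
pose T (j : int) := (\max_l size (v 0%R l) + absz j + B + s).+1.
have szT l j : (size (map_poly kappa (v 0%R l)) <= T j)%N.
  apply: leq_trans (size_poly _ _) _; apply: leq_trans (@leq_bigmax _ (fun l => size (v 0%R l)) l) _.
  by rewrite /T -!addnA -addnS leq_addr.
(* In coordinates, this is the coefficient of degree [j + B] in the relation [v *m X = 0]. *)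
have key j : \sum_l poly_act (map_poly kappa (v 0 l)) (f l) j = 0.
  apply: h_inj; rewrite raddf0 raddf_sum.
  transitivity (\sum_(i < K) (\sum_l \sum_(a < T j) (v 0 l)`_a * x l (j - a%:Z) i) *: b i).
    under [RHS]eq_bigr => i _ do rewrite scaler_suml.
    rewrite exchange_big /=; apply: eq_bigr => l _.
    rewrite (poly_act_widen _ _ (szT l j)) raddf_sum /=.
    under [RHS]eq_bigr => i _ do rewrite scaler_suml.
    rewrite exchange_big /=; apply: eq_bigr => a _.
    rewrite coef_map /= h_kappa hx scaler_sumr.
    by apply: eq_bigr => i _; rewrite scalerA.
  apply: big1 => i _; rewrite [X in X *: _](_ : _ = 0) ?scale0r //.
  case jB : (j + B%:Z) => [jj|jj]; last first.
    by apply: big1 => l _; apply: big1 => a _; rewrite x0 ?mulr0 //; lia.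
  move/matrixP: vX => /(_ 0 (widen_ord (ltnW KL) i)) /(congr1 (fun q : {poly k} => q`_jj)).
  rewrite !mxE coef0 coef_sum => vX; rewrite -[RHS]vX; apply: eq_bigr => l _.
  have jT : (jj.+1 <= T j)%N by rewrite /T; lia.
  rewrite coefM (big_ord_widen (T j) (fun a => (v 0 l)`_a * (X l (widen_ord (ltnW KL) i))`_(jj - a))) //.
  rewrite [RHS]big_mkcond /=; apply: eq_bigr => a _; case: ltnP => aj.
    by rewrite Xcoef; congr (_ * x _ _ _); lia.
  by rewrite x0 ?mulr0 //; lia.
exists (fun l => (v 0 l)`_s); split=> [|j]; first by exists l0.
(* The other terms of the relation in degree [j + s]: those with [a < s] vanish by the choice of
   [s], and those with [a > s] lie in [G (j - 1)]. *)
pose rest := \sum_l \sum_(a < T (j + s%:Z) | a != s :> nat)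
  kappa (v 0 l)`_a *: f l (j + s%:Z - a%:Z).
have -> : \sum_l kappa (v 0 l)`_s *: f l j = 0 - rest.
  apply/eqP; rewrite eq_sym subr_eq; apply/eqP; apply: etrans (esym (key (j + s%:Z))) _; rewrite /rest -big_split /=.
  apply: eq_bigr => l _; rewrite (poly_act_widen _ _ (szT l (j + s%:Z))).
  have sT : (s < T (j + s%:Z)%R)%N by rewrite /T; lia.
  rewrite (bigD1 (Ordinal sT)) //= coef_map /= addrK; congr (_ + _).
  by apply: eq_bigr => a _; rewrite coef_map.
apply: mfiltB; first exact: mfilt0.
rewrite /rest; elim/big_ind: _ => [|u1 u2|l _]; [exact: mfilt0|exact: mfiltD|].
elim/big_ind: _ => [|u1 u2|a as_]; [exact: mfilt0|exact: mfiltD|].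
case: (ltnP a s) => [lt_as|le_sa]; first by rewrite vlt // rmorph0 scale0r; exact: mfilt0.
apply: (@mfilt_mono _ _ _ _ (0%:Z + (j + s%:Z - a%:Z))); first by lia.
by apply: mfiltZ; [exact: kappaF|exact: mreesE].
Qed.

End ReesDependence.

(** * Independence of monomials along a chain of primes *)

Section PrimeChainMonomials.

Fixpoint words (s l : nat) : seq (seq nat) :=
  if l is l'.+1 then [seq i :: w | i <- iota 0 s, w <- words s l'] else [:: [::]].

Lemma size_words s l : size (words s l) = (s ^ l)%N.
Proof. by elim: l => //= l IH; rewrite size_allpairs size_iota IH expnS. Qed.

Lemma words_uniq s l : uniq (words s l).
Proof.
elim: l => //= l IH; apply: allpairs_uniq => //; first exact: iota_uniq.
by move=> [i w] [j u] _ _ [-> ->].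
Qed.

Lemma words_bound s l w : w \in words s l -> size w = l /\ all (fun i => i < s)%N w.
Proof.
elim: l w => [|l IH] w /=; first by rewrite inE => /eqP->.
case/allpairsP => -[i u] /= [+ ul ->] /=; rewrite mem_iota /= => ->.
by have [-> ->] := IH u ul.
Qed.

Variables (k : fieldType) (R : nzRingType) (kappa : {rmorphism k -> R}) (y : nat -> R).

(* The last letters come first, so that [y j] can be cancelled on the right. *)
Fixpoint word_mon (j : nat) (w : seq nat) : R :=
  if w is i :: w' then word_mon j.+1 w' * y j ^+ i else 1.

(** The lowest power of [y j] can be cancelled because [P j] is prime and does not contain [y j].
    What remains lies in the next prime, which contains [y j], so the part free of [y j] lies there
    too and the induction on [l] applies to it. *)
Lemma chain_independent (l : nat) (P : nat -> {pred R}) (s j : nat) (c : seq nat -> k) :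
  (forall i, (i <= l)%N -> spec_point (P (j + i)%N)) ->
  (forall i, (i < l)%N -> {subset P (j + i)%N <= P (j + i.+1)%N} /\
     (y (j + i) \in P (j + i.+1)%N) /\ (y (j + i) \notin P (j + i)%N)) ->
  \sum_(w <- words s l) kappa (c w) * word_mon j w \in P j ->
  forall w, w \in words s l -> c w = 0.
Proof.
elim: l j c => [|l IH] j c Pspec Pinc.
  rewrite /= big_seq1 mulr1 => Pc w; rewrite inE => /eqP->; apply/eqP/negP => /negP c0.
  have := Pspec 0%N isT; rewrite addn0 => -[[P0 P1 Pcl] _].
  case/negP: P1; have := Pcl (kappa (c [::])^-1) _ _ Pc P0.
  by rewrite addr0 -rmorphM mulVf // rmorph1.
pose Q i := \sum_(w <- words s l) kappa (c (i :: w)) * word_mon j.+1 w.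
have -> : \sum_(w <- words s l.+1) kappa (c w) * word_mon j w =
          \sum_(i <- iota 0 s) Q i * y j ^+ i.
  rewrite /= big_allpairs_dep /=; apply: eq_bigr => i _.
  by rewrite mulr_suml; apply: eq_bigr => w _; rewrite mulrA.
have := Pspec 0%N isT; rewrite addn0 => -[[P0 P1 Pcl] Pprime].
have := Pspec 1%N isT; rewrite addn1 => -[[P'0 P'1 P'cl] _].
have := Pinc 0%N isT; rewrite addn0 addn1 => -[PP' [yP' yP]] PQ.
(* The coefficients are shown to vanish in order of the exponent of [y j]. *)
suff IHt t : (t <= s)%N -> forall i w, (i < t)%N -> w \in words s l -> c (i :: w) = 0.
  move=> w /allpairsP[[i u] /= [+ ul ->]]; rewrite mem_iota /=.
  by move=> i_s; exact: (IHt s).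
elim: t => [//|t IHt] ts i w; rewrite ltnS leq_eqVlt => /predU1P[->|it]; last first.
  by apply: IHt it; exact: ltnW.
move: w; apply: (IH j.+1 (fun w => c (t :: w))) => [i' i'l|i' i'l|].
- by rewrite addSnnS; exact: Pspec.
- by rewrite !addSnnS; exact: Pinc.
have Q0 i' : (i' < t)%N -> Q i' = 0.
  move=> i't; rewrite /Q big_seq big1 // => w wl.
  by rewrite (IHt (ltnW ts) _ _ i't wl) rmorph0 mul0r.
(* The terms of exponent larger than [t], divided by [y j ^+ t.+1]. *)
pose tail := \sum_(i' <- iota t.+1 (s - t.+1)) Q i' * y j ^+ (i' - t.+1).
have cancel_pow n a : a * y j ^+ n \in P j -> a \in P j.
  elim: n a => [|n IHn] a; first by rewrite expr0 mulr1.
  by rewrite exprSr mulrA => /Pprime; rewrite (negbTE yP) orbF => /IHn.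
have Pt : Q t + tail * y j \in P j.
  apply: (cancel_pow t); move: PQ.
  have -> : iota 0 s = iota 0 t ++ t :: iota t.+1 (s - t.+1).
    by rewrite -[in LHS](subnKC ts) addSnnS iotaD add0n.
  rewrite big_cat big_cons /= big_seq big1 => [|i']; last first.
    by rewrite mem_iota add0n => /andP[_ i't]; rewrite Q0 // mul0r.
  rewrite add0r mulrDl => {}PQ; rewrite [tail * _ * _](_ : _ = \sum_(i' <- iota t.+1 (s - t.+1)) Q i' * y j ^+ i') //.
  rewrite -mulrA -exprS mulr_suml big_seq [RHS]big_seq {PQ}; apply: eq_bigr => i'.
  by rewrite mem_iota => /andP[ti' _]; rewrite -mulrA -exprD subnK.
change (Q t \in P j.+1).
have -> : Q t = - tail * y j + (Q t + tail * y j) by rewrite mulNr addrCA addNr addr0.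
by apply: P'cl => //; exact: PP'.
Qed.

End PrimeChainMonomials.

Section GradedConstants.
Variables (k R : nzRingType) (F : ring_filt R) (kappa : {rmorphism k -> R}).
Variable kappaF : forall c, F 0%N (kappa c).

(* The proof argument is there for the inference of the morphism instances. *)
Definition gr_const & (forall c, F 0%N (kappa c)) := fun c : k => gcls F 0 (kappa c).

Local Notation grc := (gr_const kappaF).

Fact gr_const_zmod_morphism : zmod_morphism grc.
Proof. by move=> a b; rewrite /gr_const rmorphB; apply: gclsB; exact: kappaF. Qed.
Fact gr_const_monoid_morphism : monoid_morphism grc.
Proof.
split=> [|a b]; first by rewrite /gr_const rmorph1 gcls_one.
by rewrite /gr_const rmorphM -[0%N in LHS]addn0 -gclsM //; exact: kappaF.
Qed.

HB.instance Definition _ :=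
  GRing.isZmodMorphism.Build k (gr F) grc gr_const_zmod_morphism.
HB.instance Definition _ :=
  GRing.isMonoidMorphism.Build k (gr F) grc gr_const_monoid_morphism.

End GradedConstants.

(** * From growth to the length of chains of primes *)

Section GrowthBoundsDimension.
Variables (k : fieldType) (R : nzRingType) (F : ring_filt R) (kappa : {rmorphism k -> R}).
Hypothesis kappaF : forall c, F 0%N (kappa c).
Variables (N : lmodType R) (G : mod_filt F N) (U : lmodType k) (h : {additive N -> U}).
Hypotheses (h_inj : injective h) (h_kappa : forall c v, h (kappa c *: v) = c *: h v).
Variables (W : nat -> U -> Prop) (C n : nat).
Hypotheses (W_mono : forall s t u, (s <= t)%N -> W s u -> W t u)
  (W0 : forall s, W s 0) (WD : forall s u v, W s u -> W s v -> W s (u + v))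
  (W_growth : forall s, exists r : seq U, (size r <= C * s.+1 ^ n)%N /\
     forall u, W s u -> exists c : 'I_(size r) -> k, u = \sum_i c i *: r`_i)
  (W_exhaustive : forall v, exists t, W t (h v))
  (W_act : forall a, exists c, forall t v, W t (h v) -> W (t + c)%N (h (a *: v))).

Lemma uniform_bound (Q : nat -> nat -> Prop) m :
  (forall i s t, (s <= t)%N -> Q i s -> Q i t) -> (forall i, exists t, Q i t) ->
  exists t, forall i, (i < m)%N -> Q i t.
Proof.
move=> Qmono Qex; elim: m => [|m [t tQ]]; first by exists 0%N.
have [t' t'Q] := Qex m; exists (maxn t t') => i.
rewrite ltnS leq_eqVlt => /predU1P[->|im].
  by apply: Qmono t'Q; exact: leq_maxr.
by apply: Qmono (tQ i im); exact: leq_maxl.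
Qed.

Definition bounded t (f : mrees G) := forall j, W t (h (f j)).

Lemma bounded_exists f : exists t, bounded t f.
Proof.
have [b fb] := mrees_supp f.
have [|i|t tP] := @uniform_bound (fun i t => W t (h (f (i%:Z - b%:Z)))) (2 * b).+1.
- by move=> i s t; exact: W_mono.
- exact: W_exhaustive.
exists t => j; have [jb|jb] := leqP `|j| b; last by rewrite fb // raddf0.
have jE : j = (absz (j + b%:Z)%R)%:Z - b%:Z by lia.
by rewrite jE; apply: tP; lia.
Qed.

Lemma bounded_act (a : rees F) : exists c, forall t f, bounded t f ->
  bounded (t + c) (mrees_act a f).
Proof.
have [||c cP] := @uniform_bound (fun i c => forall t v, W t (h v) ->
    W (t + c)%N (h ((rees_val a)`_i *: v))) (size (rees_val a)).
- move=> i s t st H t' v Wv; apply: W_mono (H _ _ Wv).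
  by rewrite leq_add2l.
- by move=> i; exact: W_act.
exists c => t f ft j; rewrite /= /poly_act raddf_sum.
elim/big_ind: _ => [|u v|i _]; [exact: W0|exact: WD|].
by apply: cP => //; exact: ft.
Qed.

(** The [s ^ l] monomials in lifts of the [y i] send the lift [u'] into the subspace
    [W (t0 + c * s * l)], of dimension [O(s ^ n)]. If they outnumbered its spanning vectors,
    [rees_dependence] would give a nontrivial combination of the monomials killing [u], hence in
    [P 0], contrary to [chain_independent]. *)
Theorem chain_length_le_growth l (P : nat -> {pred gr F}) :
  (forall i, (i <= l)%N -> spec_point (P i)) -> Defs.support (gr_mod G) (P 0%N) ->
  (forall i, (i < l)%N ->
     {subset P i <= P i.+1} /\ exists a, a \in P i.+1 /\ a \notin P i) ->
  (l <= n)%N.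
Proof.
move=> Pspec [_ [u annu]] Pinc; rewrite leqNgt; apply/negP => nl.
have /choice[y yP] : forall i, exists y : gr F, (i < l)%N -> y \in P i.+1 /\ y \notin P i.
  move=> i.
  case: (ltnP i l) => [il|_]; last by exists 0.
  by have [_ [a aP]] := Pinc i il; exists a.
pose Y i : rees F := gr_repr (y i); pose u' := grm_repr u.
have YE j w : gr_class (word_mon Y j w) = word_mon y j w.
  elim: w j => [//|i w IH] j /=; rewrite -IH -[LHS]gr_classM; congr (gr_mul _ _).
  elim: i => [//|i IHi]; rewrite !exprSr -IHi -[y j]gr_reprK.
  by rewrite -[LHS]gr_classM.
have [c cP] : exists c, forall i, (i < l)%N -> forall t f, bounded t f ->
    bounded (t + c) (mrees_act (Y i) f).
  apply: uniform_bound => [i s t st H t' f ft j|i]; last exact: bounded_act.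
  by apply: W_mono (H _ _ ft j); rewrite leq_add2l.
have [t0 t0P] := bounded_exists u'.
have powP i e t f : (i < l)%N -> bounded t f -> bounded (t + c * e) (mrees_act (Y i ^+ e) f).
  move=> il; elim: e t f => [|e IH] t f ft.
    by rewrite expr0 mrees_act1 muln0 addn0.
  by rewrite exprSr mrees_actM mulnS addnA; apply: IH; exact: cP.
have wordP s j w t f : (j + size w <= l)%N -> all (fun i => i < s)%N w -> bounded t f ->
    bounded (t + c * s * size w) (mrees_act (word_mon Y j w) f).
  elim: w j t f => [|i w IH] j t f /= jl; first by rewrite mrees_act1 muln0 addn0.
  case/andP => lt_is ws ft; rewrite mrees_actM mulnS addnA.
  apply: IH => //; first by rewrite addSnnS.
  have jl' : (j < l)%N by apply: leq_trans jl; rewrite -addSnnS leq_addr.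
  move=> j'; apply: W_mono (powP j i t f jl' ft j').
  by rewrite leq_add2l leq_mul2l (ltnW lt_is) orbT.
(* As [t0 + c * s * l + 1] is at most [s * (t0 + c * l + 1)], the dimension is at most [s ^ n * D];
   taking [s > D] makes this smaller than [s ^ n.+1]. *)
pose D := (C * (t0 + c * l).+1 ^ n)%N; pose s := D.+1.
have [r [rsize rP]] := W_growth (t0 + c * s * l).
have le_sr : (s ^ l <= size r)%N.
  rewrite leqNgt; apply/negP; rewrite -(size_words s l) => lt_r.
  pose f (i : 'I_(size (words s l))) := mrees_act (word_mon Y 0 (nth [::] (words s l) i)) u'.
  have [i j|a [[i0 ai0] aP]] := rees_dependence (f := f) kappaF h_inj h_kappa (b := fun i => r`_i) lt_r.
    apply: rP; have [ws wb] := words_bound (mem_nth [::] (ltn_ord i)).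
    by rewrite -ws; apply: wordP => //; rewrite ws.
  (* The coefficients indexed by words instead of positions, with 0 for words outside the list. *)
  pose a' w := if insub (index w (words s l)) is Some i then a i else 0.
  have a'E (i : 'I_(size (words s l))) : a' (nth [::] (words s l) i) = a i.
    rewrite /a' index_uniq ?words_uniq // insubT // => lt_i.
    by congr a; apply: val_inj.
  suff a'0 : a' (nth [::] (words s l) i0) = 0 by rewrite -a'E a'0 eqxx in ai0.
  apply: (@chain_independent k (gr F) (gr_const kappaF) y l P s 0 a' Pspec).
  - by move=> i il; rewrite !add0n; have [PP _] := Pinc i il; split=> //; exact: yP.
  - apply: annu; rewrite -[u]grm_reprK -/u' scaler_suml.
    have wE w : (gr_const kappaF (a' w) * word_mon y 0 w) *: grm_class u' =
        grm_class (mrees_act (hrees F 0 (kappa (a' w)) * word_mon Y 0 w) u').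
      by rewrite -YE [X in X *: _](gr_classM (hrees F 0 _) (word_mon Y 0 w)) [LHS]gr_scaleE.
    under eq_bigr do rewrite wE.
    rewrite /grm_class -raddf_sum -[LHS]/(grm_class _).
    have <- : grm_class (0 : mrees G) = 0 by rewrite /grm_class raddf0.
    apply/grm_classP; rewrite subr0; apply/mrees_shiftP => j; rewrite mrees_val_sum.
    move: (aP j); congr (G _ _); rewrite (big_nth [::]) big_mkord.
    apply: eq_bigr => i _; rewrite -a'E mrees_actM /= hreesE //.
    by rewrite expr0 -mul_polyC poly_actC poly_act1.
  - exact: mem_nth.
have : (s ^ n * s <= s ^ n * D)%N.
  rewrite -expnSr; apply: leq_trans (leq_pexp2l _ nl) _ => //.
  apply: leq_trans le_sr _; apply: leq_trans rsize _.
  rewrite mulnCA leq_mul2l /D -expnMn; apply/orP; right.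
  have expn_le a b : (a <= b)%N -> (a ^ n <= b ^ n)%N.
    by case: (n) => // n' ab; rewrite leq_exp2r.
  by apply: expn_le; rewrite /s; nia.
by rewrite leq_mul2l expn_eq0 /= ltnn.
Qed.

End GrowthBoundsDimension.

(** * Operators on A *)

Section Operators.
Variables (k : fieldType) (A : comAlgType k) (n : nat) (d : 'I_n -> kend A).

Definition fop (a : A) : diff_ring d := GenRing (subring_span_gen (OpFun d a)).
Definition vop (i : 'I_n) : diff_ring d := GenRing (subring_span_gen (OpVec d i)).

Lemma diff_ring_eq (P Q : diff_ring d) : gen_val P =1 gen_val Q -> P = Q.
Proof. by move=> PQ; apply: val_inj; apply: kend_eq. Qed.

Fact fop_zmod_morphism : zmod_morphism fop.
Proof. by move=> a b; apply: diff_ring_eq => c; exact: mulrBl. Qed.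
Fact fop_monoid_morphism : monoid_morphism fop.
Proof.
split=> [|a b]; apply: diff_ring_eq => c; first exact: mul1r.
by symmetry; exact: mulrA.
Qed.
HB.instance Definition _ :=
  GRing.isZmodMorphism.Build A (diff_ring d) fop fop_zmod_morphism.
HB.instance Definition _ :=
  GRing.isMonoidMorphism.Build A (diff_ring d) fop fop_monoid_morphism.

Definition cop : {rmorphism k -> diff_ring d} := fop \o in_alg A.

Lemma cop_central c (P : diff_ring d) : P * cop c = cop c * P.
Proof.
apply: diff_ring_eq => a; change (gen_val P (c%:A * a) = c%:A * gen_val P a).
rewrite -!scalerAl !mul1r -[c *: a]addr0 kendP.
have -> : gen_val P 0 = 0.
  by have := kendP (gen_val P) (-1) 0 0; rewrite scaler0 addr0 scaleN1r addNr.
by rewrite addr0.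
Qed.

Lemma order_exhaustive (P : diff_ring d) : exists p, order_filt d p P.
Proof.
have widen p q Q : (p <= q)%N -> op_order_le d p Q -> op_order_le d q Q.
  move=> pq Qp; rewrite -[Q]mul1r -(subnK pq); apply: OrdMul => //.
  exact: op_order_le_one.
have /asboolP : gen_val P \in (fun Q => `[< exists p, op_order_le d p Q >]).
  apply: subring_span_sub (valP P).
    split=> [|a b /asboolP[p ap] /asboolP[q bq]|a b /asboolP[p ap] /asboolP[q bq]];
      apply/asboolP.
    - by exists 0%N; exact: op_order_le_one.
    - by exists (maxn p q); apply: OrdSub; [apply: widen ap|apply: widen bq];
        rewrite ?leq_maxl ?leq_maxr.
    - by exists (p + q)%N; exact: OrdMul.
  move=> _ [a|i]; apply/asboolP; first by exists 0%N; exact: OrdFun.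
  by exists 1%N; exact: OrdVec.
by [].
Qed.

Lemma order_le_lift q (P : kend A) :
  op_order_le d q P -> exists a : diff_ring d, gen_val a = P.
Proof.
elim=> [b a|b i|b X Y _ [a <-] _ [a' <-]|b b' X Y _ [a <-] _ [a' <-]].
- by exists (fop a).
- by exists (vop i).
- by exists (a - a').
- by exists (a * a').
Qed.

(** [op_order_le] speaks of endomorphisms of [A]; since each of finite order lifts to [diff_ring d],
    the induction can be run inside that ring. *)
Lemma order_filt_ind (Q : nat -> diff_ring d -> Prop) :
  (forall q a, Q q (fop a)) -> (forall q i, Q q.+1 (vop i)) ->
  (forall q P P', order_filt d q P -> order_filt d q P' ->
     Q q P -> Q q P' -> Q q (P - P')) ->
  (forall q q' P P', order_filt d q P -> order_filt d q' P' ->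
     Q q P -> Q q' P' -> Q (q + q')%N (P * P')) ->
  forall q P, order_filt d q P -> Q q P.
Proof.
move=> Qfop Qvop QB QM q P; rewrite -[order_filt d q P]/(op_order_le d q (gen_val P)).
move: {1 3}(gen_val P) (erefl (gen_val P)) => X XP Xq; elim: Xq P XP => {q X}.
- by move=> q a P PX; have -> : P = fop a by apply: val_inj.
- by move=> q i P PX; have -> : P = vop i by apply: val_inj.
- move=> q X Y qX IHX qY IHY P PX.
  have [a aX] := order_le_lift qX; have [b bY] := order_le_lift qY.
  have -> : P = a - b by apply: val_inj; rewrite /= -PX -aX -bY.
  by apply: QB; [rewrite /= /order_le aX|rewrite /= /order_le bY|exact: IHX|exact: IHY].
- move=> q q' X Y qX IHX qY IHY P PX.
  have [a aX] := order_le_lift qX; have [b bY] := order_le_lift qY.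
  have -> : P = a * b by apply: val_inj; rewrite /= -PX -aX -bY.
  by apply: QM; [rewrite /= /order_le aX|rewrite /= /order_le bY|exact: IHX|exact: IHY].
Qed.

Hypothesis dder : forall i, derivation (d i).

Lemma derivation1 i : d i 1 = 0.
Proof.
by have /eqP := dder i 1 1; rewrite !mulr1 mul1r -subr_eq0 opprD addrA subrr sub0r oppr_eq0 => /eqP.
Qed.

Lemma vop_fop i a : vop i * fop a = fop a * vop i + fop (d i a).
Proof.
apply: diff_ring_eq => b; change (d i (a * b) = a * d i b + d i a * b).
exact: dder.
Qed.

Hypothesis dcomm : forall i j a, d i (d j a) = d j (d i a).

Lemma vopC i j : vop i * vop j = vop j * vop i.
Proof. by apply: diff_ring_eq => a; exact: dcomm. Qed.

Definition vmon (m : 'X_{1..n}) : diff_ring d := mmap1 vop m.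

Lemma vmonS j m : vop j * vmon m = vmon (m + U_(j)).
Proof.
rewrite -{1}(mmap1U vop j) /vmon /mmap1 -prodrM_comm; last first.
  move=> i i' _ _; apply: commrX; apply: commr_sym; apply: commrX.
  exact: vopC.
by apply: eq_bigr => i _; rewrite -exprD mnmDE addnC.
Qed.

(** The commutator is a derivation in each argument, so the bound on its order reduces to the
    generators, where the only nonzero commutators are those of a vector field with a function, and
    these are functions. *)
Lemma order_commutator p q (P Q : diff_ring d) : order_filt d p P -> order_filt d q Q ->
  rfilt_pred (order_filt d) (p + q) (P * Q - Q * P).
Proof.
pose F := order_filt d; pose br (X Y : kend A) := X * Y - Y * X.
suff H (X Y : kend A) : op_order_le d p X -> op_order_le d q Y ->
    match (p + q)%N with s.+1 => op_order_le d s (br X Y) | 0 => br X Y = 0 end.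
  move=> Pp Qq; have := H _ _ Pp Qq; rewrite /rfilt_pred; case: (p + q)%N => [E|s] //=.
  by apply: val_inj.
(* [C s Z] says that [Z] has order at most [s - 1], which for [s = 0] means [Z = 0]. *)
pose C s Z := match s with s'.+1 => op_order_le d s' Z | 0 => Z = 0 end.
rewrite -/(C (p + q)%N (br X Y)).
have CB s Z Z' : C s Z -> C s Z' -> C s (Z - Z').
  by case: s => [-> ->|s]; [rewrite subrr|exact: OrdSub].
have C0 s : C s 0.
  by case: s => //= s; rewrite -(subrr 1); apply: OrdSub; exact: op_order_le_one.
have CD s Z Z' : C s Z -> C s Z' -> C s (Z + Z').
  move=> CZ CZ'; rewrite -[Z']opprK; apply: (CB) => //; rewrite -sub0r; exact: CB.
have CMl s t Z Z' : op_order_le d s Z -> C t Z' -> C (s + t)%N (Z * Z').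
  case: t => [_ ->|t sZ tZ]; first by rewrite mulr0.
  by rewrite addnS; exact: OrdMul.
have CMr s t Z Z' : C s Z -> op_order_le d t Z' -> C (s + t)%N (Z * Z').
  case: s => [-> _|s sZ tZ]; first by rewrite mul0r.
  by rewrite addSn; exact: OrdMul.
move=> pX qY; elim: pX q Y qY => {p X} [p a|p i|p X X' _ IHX _ IHX'|p p' X X' pX IHX pX' IHX'] q Y qY.
- elim: qY => {q Y} [q b|q j|q Y Y' _ IHY _ IHY'|q q' Y Y' qY IHY qY' IHY'].
  + by rewrite (_ : br _ _ = 0) //; apply: kend_eq => c; apply/eqP; rewrite subr_eq0;
      apply/eqP; exact: mulrCA.
  + rewrite addnS (_ : br _ _ = 0 - mulop (d j a)); last first.
      apply: kend_eq => c; change (a * d j c - d j (a * c) = 0 - d j a * c).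
      by rewrite dder opprD addrA subrr.
    by apply: OrdSub; [exact: (C0 _.+1)|exact: OrdFun].
  + have -> : br (mulop a) (Y - Y') = br (mulop a) Y - br (mulop a) Y'.
      by rewrite /br mulrBr mulrBl !opprD !opprK addrACA.
    exact: CB.
  + have -> : br (mulop a) (Y * Y') = br (mulop a) Y * Y' + Y * br (mulop a) Y'.
      by rewrite /br mulrBr mulrBl !mulrA addrA subrK.
    apply: CD; first by rewrite addnA; exact: CMr.
    by rewrite addnCA; exact: CMl.
- elim: qY => {q Y} [q b|q j|q Y Y' _ IHY _ IHY'|q q' Y Y' qY IHY qY' IHY'].
  + rewrite addSn (_ : br _ _ = mulop (d i b)); first exact: OrdFun.
    apply: kend_eq => c; change (d i (b * c) - b * d i c = d i b * c).
    by rewrite dder addrC addrA addNr add0r.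
  + rewrite (_ : br _ _ = 0) //; apply: kend_eq => c.
    by change (d i (d j c) - d j (d i c) = 0); rewrite dcomm subrr.
  + have -> : br (d i) (Y - Y') = br (d i) Y - br (d i) Y'.
      by rewrite /br mulrBr mulrBl !opprD !opprK addrACA.
    exact: CB.
  + have -> : br (d i) (Y * Y') = br (d i) Y * Y' + Y * br (d i) Y'.
      by rewrite /br mulrBr mulrBl !mulrA addrA subrK.
    apply: CD; first by rewrite addnA; exact: CMr.
    by rewrite addnCA; exact: CMl.
- have -> : br (X - X') Y = br X Y - br X' Y.
    by rewrite /br mulrBr mulrBl !opprD !opprK addrACA.
  by apply: CB; [exact: IHX|exact: IHX'].
- have -> : br (X * X') Y = X * br X' Y + br X Y * X'.
    by rewrite /br mulrBr mulrBl !mulrA addrA subrK.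
  apply: CD; first by rewrite -addnA; apply: CMl => //; exact: IHX'.
  by rewrite addnAC; apply: CMr => //; exact: IHX.
Qed.

Lemma gr_order_comm : commutative (@GRing.mul (gr (order_filt d))).
Proof.
move=> a b; rewrite -[a]gr_reprK -[b]gr_reprK; move: (gr_repr a) (gr_repr b) => {a b} f g.
rewrite [LHS]gr_classM [RHS]gr_classM; apply/gr_classP/rees_shiftP => s.
rewrite rees_valB !rees_valM coefB coefM [X in _ - X]coefMr -sumrB.
apply: rfilt_pred_sum => i; rewrite -[in X in rfilt_pred _ X](subnKC (_ : (i <= s)%N)); last first.
  by rewrite -ltnS.
by apply: order_commutator; exact: reesE.
Qed.

End Operators.

(** The tower is identified with the polynomials in the [e] distinct variables [j 0], ...,
    [j (e - 1)], the outermost variable going to the last of them. *)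
Lemma tower_embedding (k : idomainType) N (j : nat -> 'I_N) e :
  (forall a b, (a < e)%N -> (b < e)%N -> j a = j b -> a = b) ->
  exists eta : {rmorphism tower k e -> {mpoly k[N]}},
    [/\ forall c, eta (tower_const e c) = mpolyC N (c : k),
        forall a, eta a = 0 -> a = 0
      & forall a m x, m \in msupp (eta a) -> (forall i, (i < e)%N -> j i != x) -> m x = 0%N].
Proof.
elim: e => [_|e IH jinj].
  exists (@mpolyC N k : {rmorphism k -> {mpoly k[N]}}); split=> // [a|a m x].
    by move/eqP; rewrite mpolyC_eq0 => /eqP.
  by rewrite msuppC; case: eqP => // _; rewrite inE => /eqP-> _; rewrite mnm0E.
have [|eta [etaC eta_inj eta_supp]] := IH.
  by move=> a b ae be; apply: jinj; apply: ltnW.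
pose X : {mpoly k[N]} := 'X_(j e).
have cX : commr_rmorph eta X by move=> a; exact: mulrC.
have etaE (a : {poly tower k e}) :
    horner_morph cX a = \sum_(t < size a) eta a`_t * 'X_[U_(j e) *+ t].
  rewrite /horner_morph (@horner_coef_wide _ (size a)) ?size_poly //.
  by apply: eq_bigr => t _; rewrite coef_map mpolyXn.
have suppX (a : {poly tower k e}) t m :
    m \in msupp (eta a`_t * 'X_[U_(j e) *+ t]) -> m (j e) = t /\
      forall x, (forall i, (i < e.+1)%N -> j i != x) -> m x = 0%N.
  move=> /msuppM_le/allpairsP[[m1 m2]] /= [m1a]; rewrite msuppX inE => /eqP-> ->.
  split=> [|x jx]; rewrite mnmDE mulmnE mnm1E.
    rewrite (eta_supp _ _ _ m1a) ?add0n ?eqxx ?mul1n // => i ie.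
    by apply/eqP => /(jinj _ _ (ltnW ie) (ltnSn e)) ijE; move: ie; rewrite ijE ltnn.
  rewrite (eta_supp _ _ _ m1a); last by move=> i ie; apply: jx; apply: ltnW.
  by rewrite (negbTE (jx e _)).
exists (horner_morph cX); split=> [c|a a0|a m x].
- by rewrite /= horner_morphC etaC.
- apply/polyP => t; rewrite coef0; apply: eta_inj; apply/mpolyP => m.
  rewrite mcoeff0; apply/eqP; rewrite mcoeff_eq0; apply/negP => mt.
  have [ts|ts] := leqP (size a) t.
    by move: mt; rewrite nth_default // rmorph0 msupp0.
  have : (horner_morph cX a)@_(U_(j e) *+ t + m) = 0 by rewrite [horner_morph _ _]a0 mcoeff0.
  rewrite etaE raddf_sum (bigD1 (Ordinal ts)) //= mcoeffMX big1 ?addr0.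
    by move/eqP; rewrite mcoeff_eq0 mt.
  move=> t' tt'; apply/eqP; rewrite mcoeff_eq0; apply/negP => /suppX[+ _].
  rewrite mnmDE mulmnE mnm1E eqxx mul1n (eta_supp _ _ _ mt) ?addn0.
    by move=> tE; case/eqP: tt'; apply: val_inj; rewrite /= tE.
  by move=> i ie; apply/eqP => /(jinj _ _ (ltnW ie) (ltnSn e)) ijE; move: ie; rewrite ijE ltnn.
- rewrite /= etaE => /msupp_sum_le/flattenP[_ /mapP[t _ ->]].
  by move=> /suppX[_ H] jx; apply: H.
Qed.

Lemma char0_natr (k : fieldType) : [pchar k] =i pred0 -> forall n, n.+1%:R != 0 :> k.
Proof. by move=> /pcharf0P char0 n; rewrite char0. Qed.

(** * Monomial generators of a D-module *)

Section BlockMonomials.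
Variables r n : nat.
Implicit Type m : 'X_{1..r + n}.

(** The first [r] exponents belong to the generators of [A], the last [n] to the vector fields. *)
Definition mleft m : 'X_{1..r} := [multinom m (lshift n i) | i < r].
Definition mright m : 'X_{1..n} := [multinom m (rshift r j) | j < n].
Definition is_right : pred 'I_(r + n) := fun x => (r <= x)%N.

Lemma mleftD m m' : mleft (m + m') = (mleft m + mleft m')%MM.
Proof. by apply/mnmP => i; rewrite !(mnmE, mnmDE). Qed.
Lemma mrightD m m' : mright (m + m') = (mright m + mright m')%MM.
Proof. by apply/mnmP => i; rewrite !(mnmE, mnmDE). Qed.
Lemma mleft_l i : mleft U_(lshift n i) = U_(i)%MM.
Proof. by apply/mnmP => j; rewrite mnmE !mnm1E (inj_eq (@lshift_inj _ _)). Qed.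
Lemma mleft_r j : mleft U_(rshift r j) = 0%MM.
Proof. by apply/mnmP => i; rewrite mnmE mnm1E mnm0E eq_rlshift. Qed.
Lemma mright_l i : mright U_(lshift n i) = 0%MM.
Proof. by apply/mnmP => j; rewrite mnmE mnm1E mnm0E eq_lrshift. Qed.
Lemma mright_r j : mright U_(rshift r j) = U_(j)%MM.
Proof. by apply/mnmP => i; rewrite mnmE !mnm1E (inj_eq (@rshift_inj _ _)). Qed.
Lemma mleft0 : mleft 0 = 0%MM.
Proof. by apply/mnmP => i; rewrite mnmE !mnm0E. Qed.
Lemma mright0 : mright 0 = 0%MM.
Proof. by apply/mnmP => i; rewrite mnmE !mnm0E. Qed.

Lemma is_right_l i : is_right (lshift n i) = false.
Proof. by rewrite /is_right /= leqNgt ltn_ord. Qed.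
Lemma is_right_r j : is_right (rshift r j) = true.
Proof. by rewrite /is_right /= leq_addr. Qed.

Lemma pdeg_mright m : pdeg is_right m = mdeg (mright m).
Proof.
rewrite /pdeg mdegE big_mkcond big_split_ord /= big1 ?add0n => [|i _].
  by apply: eq_bigr => j _; rewrite is_right_r mnmE.
by rewrite is_right_l.
Qed.

Lemma mdeg_blocks m : mdeg m = (mdeg (mleft m) + mdeg (mright m))%N.
Proof.
rewrite !mdegE big_split_ord /=; congr (_ + _)%N; apply: eq_bigr => i _; by rewrite mnmE.
Qed.

Definition join_l (a : 'X_{1..r}) (m : 'X_{1..r + n}) : 'X_{1..r + n} :=
  [multinom match fintype.split x with inl i => a i | inr j => m x end | x < r + n].

Lemma mleft_join a m : mleft (join_l a m) = a.
Proof.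
by apply/mnmP => i; rewrite !mnmE -[lshift n i]/(unsplit (inl i)) unsplitK.
Qed.
Lemma mright_join a m : mright (join_l a m) = mright m.
Proof.
by apply/mnmP => j; rewrite !mnmE -[rshift r j]/(unsplit (inr j)) unsplitK.
Qed.

End BlockMonomials.

Section SpannedModules.
Variables (R : nzRingType) (N : lmodType R) (K : R -> Prop).
Hypotheses (K0 : K 0) (K1 : K 1) (KD : forall a b, K a -> K b -> K (a + b))
  (KM : forall a b, K a -> K b -> K (a * b)).

(** The coefficient set [K] consists of the operators of order 0 when coherence is proved, and of
    all scalars for finite generation and growth. *)
Definition comb_of (s : seq N) (u : N) :=
  exists c : 'I_(size s) -> R, (forall i, K (c i)) /\ u = \sum_i c i *: s`_i.

Lemma comb_of0 s : comb_of s 0.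
Proof. by exists (fun=> 0); split=> //; rewrite big1 // => i _; rewrite scale0r. Qed.
Lemma comb_ofD s u v : comb_of s u -> comb_of s v -> comb_of s (u + v).
Proof.
move=> [c [Kc ->]] [c' [Kc' ->]]; exists (fun i => c i + c' i); split=> [i|].
  exact: KD.
by rewrite -big_split; apply: eq_bigr => i _; rewrite scalerDl.
Qed.
Lemma comb_ofZ s a u : K a -> comb_of s u -> comb_of s (a *: u).
Proof.
move=> Ka [c [Kc ->]]; exists (fun i => a * c i); split=> [i|]; first exact: KM.
by rewrite scaler_sumr; apply: eq_bigr => i _; rewrite scalerA.
Qed.
Lemma comb_of_mem s u : u \in s -> comb_of s u.
Proof.
move=> us; have lt_u : (index u s < size s)%N by rewrite index_mem.
exists (fun i => (i == Ordinal lt_u)%:R); split=> [i|]; first by case: (i == _).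
rewrite (bigD1 (Ordinal lt_u)) //= eqxx scale1r nth_index // big1 ?addr0 //.
by move=> i /negbTE->; rewrite scale0r.
Qed.

End SpannedModules.

(** * The order filtration of a D-module and its symbols *)

Section Module.
Variables (k : fieldType) (A : comAlgType k) (n : nat) (d : 'I_n -> kend A).
Hypotheses (dder : forall i, derivation (d i))
  (dcomm : forall i j a, d i (d j a) = d j (d i a)).
Variables (r : nat) (g : {rmorphism {mpoly k[r]} -> A}).
Hypotheses (gC : forall c, g (mpolyC r c) = c%:A) (g_surj : forall a, exists q, g q = a).
Variables (M : lmodType (diff_ring d)) (w : seq M).

Local Notation D := (diff_ring d).
Local Notation F := (order_filt d).
Local Notation V := (restr (cop d) M).
Local Notation index := ('X_{1..r + n} * 'I_(size w))%type.
Local Notation p := (@is_right r n).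

Lemma restr_scaleE c (v : V) : c *: v = cop d c *: (v : M). Proof. by []. Qed.

Definition basis_op (m : 'X_{1..r + n}) : D :=
  fop d (g 'X_[mleft m]) * vmon d (mright m).
Definition monvec (x : index) : V := (basis_op x.1 *: (w`_x.2 : M) : M).
Definition gen_op (x : 'I_(r + n)) : D :=
  match fintype.split x with inl i => fop d (g 'X_i) | inr j => vop d j end.
Definition gen_act (x : 'I_(r + n)) (v : V) : V := (gen_op x *: (v : M) : M).

Lemma gen_op_l i : gen_op (lshift n i) = fop d (g 'X_i).
Proof. by rewrite /gen_op -[lshift n i]/(unsplit (inl i)) unsplitK. Qed.
Lemma gen_op_r j : gen_op (rshift r j) = vop d j.
Proof. by rewrite /gen_op -[rshift r j]/(unsplit (inr j)) unsplitK. Qed.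

Lemma scale_central (P : D) c (v : V) : ((P *: (c *: v : M) : M) : V) = c *: ((P *: (v : M) : M) : V).
Proof. by rewrite !restr_scaleE !scalerA cop_central. Qed.

Lemma gen_act_linear x : linear (gen_act x).
Proof.
by move=> c u v; rewrite /gen_act -scale_central -[RHS]scalerDr.
Qed.

(** By the Leibniz rule, a derivation replaces one generator of [A] in a monomial by its derivative;
    [c] bounds the sizes of polynomials representing these finitely many derivatives. *)
Lemma derivation_bound : exists c, forall j m, exists q,
  d j (g 'X_[m]) = g q /\ forall a, a \in msupp q -> (mdeg a < mdeg m + c)%N.
Proof.
have /choice[q qP] : forall ji : 'I_n * 'I_r, exists q, g q = d ji.1 (g 'X_(ji.2)).
  by move=> ji; exact: g_surj.
pose c := \max_(ji : 'I_n * 'I_r) msize (q ji); exists c => j m.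
have d0 (P : kend A) : P 0 = 0.
  by have := kendP P (-1) 0 0; rewrite scaler0 addr0 scaleN1r addNr.
have up : upward_closed (fun m : 'X_{1..r} => exists q,
    d j (g 'X_[m]) = g q /\ forall a, a \in msupp q -> (mdeg a < mdeg m + c)%N).
  apply: upward_by_shift => {m}m i [q' [dq' q'c]].
  exists ('X_[m] * q (j, i) + q' * 'X_i); split.
    by rewrite mpolyXD rmorphM dder rmorphD !rmorphM -dq' qP.
  move=> a /msuppD_le; rewrite mem_cat mdegD mdeg1 => /orP[] /msuppM_le/allpairsP[[a1 a2]] /=.
    rewrite msuppX inE => -[/eqP-> /msize_mdeg_lt a2q ->]; rewrite mdegD.
    have : (msize (q (j, i)) <= c)%N by exact: (leq_bigmax (j, i)).
    by move: a2q; lia.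
  rewrite [msupp 'X_i]msuppX inE => -[/q'c a1q /eqP-> ->]; rewrite mdegD mdeg1.
  by move: a1q; lia.
apply: (up 0%MM); first by apply/mnm_lepP => i; rewrite mnm0E.
exists 0; rewrite mpolyX0 rmorph1 derivation1 // rmorph0; split=> // a.
by rewrite msupp0.
Qed.

Lemma basis_op_l i m : gen_op (lshift n i) * basis_op m = basis_op (m + U_(lshift n i)).
Proof.
rewrite gen_op_l /basis_op mleftD mrightD mleft_l mright_l addm0 mulrA -rmorphM -rmorphM.
by rewrite -mpolyXD addmC.
Qed.

Lemma basis_op_r j m : gen_op (rshift r j) * basis_op m =
  basis_op (m + U_(rshift r j)) + fop d (d j (g 'X_[mleft m])) * vmon d (mright m).
Proof.
rewrite gen_op_r /basis_op mleftD mrightD mleft_r mright_r addm0 mulrA vop_fop //.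
by rewrite mulrDl -mulrA vmonS.
Qed.

Local Notation is0 := (fun v : V => v = 0).
Local Notation mspanV := (@mspan _ V is0 _ _ monvec).

Lemma is0_closed (a : k) (u v : V) : u = 0 -> v = 0 -> a *: u + v = 0.
Proof. by move=> -> ->; rewrite scaler0 addr0. Qed.

Lemma function_span (q : {mpoly k[r]}) m i (X : index -> Prop) :
  (forall a, a \in msupp q -> X (join_l a m, i)) ->
  mspanV X ((fop d (g q) * vmon d (mright m)) *: (w`_i : M) : M).
Proof.
move=> Xq; rewrite (mpolyE q) !raddf_sum /=.
rewrite mulr_suml scaler_suml -[X in mspan _ _ _ X]/(\sum_(a <- msupp q) _ : V).
apply: (mspan_sum (erefl 0)) => a aq.
rewrite -mul_mpolyC rmorphM gC rmorphM -mulrA -scalerA.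
apply: (mspanZ (erefl 0)).
suff -> : ((fop d (g 'X_[a]) * vmon d (mright m)) *: w`_i : M) = monvec (join_l a m, i).
  by apply: MspanGen; exact: Xq.
by rewrite /monvec /basis_op mleft_join mright_join.
Qed.
(** The only correction comes from differentiating the function part of a monomial. It has one
    vector field fewer, and its degree in the generators of [A] grows by less than the [c] of
    [derivation_bound], which is therefore a sufficient weight. *)
Lemma gen_act_shift : exists w0, forall x y,
  mspanV (fun z => (pdeg p z.1 < pdeg p (shift y x).1)%N /\
                   (weight p w0 z.1 <= weight p w0 (shift y x).1)%N)
         (gen_act x (monvec y) - monvec (shift y x)).
Proof.
have [c cP] := derivation_bound; exists c => x [m i].
rewrite /gen_act /monvec /= scalerA.
case: (split_ordP x) => [a ->|j ->]; first by rewrite basis_op_l subrr; exact: MspanBase.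
rewrite basis_op_r scalerDl.
rewrite [X in mspan _ _ _ X](addrAC _ _ (- _)) subrr add0r.
have [q [-> qc]] := cP j (mleft m); apply: function_span => a aq.
rewrite /weight !pdeg_mright !mdeg_blocks mleft_join mright_join mleftD mrightD.
rewrite mleft_r mright_r addm0 !mdegD mdeg1.
by have := qc a aq; split; nia.
Qed.

Lemma basis0 i : monvec (0%MM, i) = w`_i.
Proof.
by rewrite /monvec /basis_op /= mleft0 mright0 mpolyX0 rmorph1 rmorph1 mul1r /vmon mmap11 scale1r.
Qed.

Section Raising.
Variable omega : 'X_{1..r + n} -> nat.
Hypothesis omegaD : forall m m', omega (m + m') = (omega m + omega m')%N.
Hypothesis gen_act_omega : forall x y,
  mspanV (fun z => (omega z.1 <= omega (shift y x).1)%N) (gen_act x (monvec y)).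

(** [omega] will be [pdeg] for the order filtration and [weight] for the growth estimate. *)
Definition raises c (P : D) := forall t (v : V),
  mspanV (fun y => (omega y.1 <= t)%N) v ->
  mspanV (fun y => (omega y.1 <= t + c)%N) ((P *: (v : M) : M) : V).

Lemma raises_mono c c' P : (c <= c')%N -> raises c P -> raises c' P.
Proof.
move=> cc' Pc t v /Pc; apply: mspan_mono => y /leq_trans; apply.
by rewrite leq_add2l.
Qed.

Lemma raisesB c P Q : raises c P -> raises c Q -> raises c (P - Q).
Proof.
move=> Pc Qc t v tv; have -> : (((P - Q) *: (v : M) : M) : V) =
    ((P *: (v : M) : M) : V) - ((Q *: (v : M) : M) : V).
  exact (scalerBl P Q (v : M)).
by apply: mspanB; [exact: Pc|exact: Qc].
Qed.

Lemma raisesD c P Q : raises c P -> raises c Q -> raises c (P + Q).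
Proof.
move=> Pc Qc t v tv; have -> : (((P + Q) *: (v : M) : M) : V) =
    ((P *: (v : M) : M) : V) + ((Q *: (v : M) : M) : V).
  exact (scalerDl (v : M) P Q).
by apply: mspanD; [exact: Pc|exact: Qc].
Qed.

Lemma raisesM c c' P Q : raises c P -> raises c' Q -> raises (c + c') (P * Q).
Proof.
by move=> Pc Qc t v tv; rewrite -scalerA [(c + c')%N]addnC addnA; apply: Pc; apply: Qc.
Qed.

Lemma raises_cop c : raises 0 (cop d c).
Proof. by move=> t v tv; rewrite addn0; apply: (mspanZ (erefl 0)). Qed.

Lemma raises_gen x : raises (omega U_(x)) (gen_op x).
Proof.
move=> t v; elim=> [u ->|y yt|c u u' _ IHu _ IHu'].
- by rewrite scaler0; exact: MspanBase.
- apply: mspan_mono (gen_act_omega x y) => z /leq_trans; apply.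
  by rewrite /= omegaD leq_add2r.
- by rewrite -[gen_op x *: _]/(gen_act x _) gen_act_linear; exact: MspanLin.
Qed.

(** [K] is the set of permitted increases: only 0 when functions must have order 0, and every number
    when any bound will do. *)
Lemma raises_fop (K : nat -> Prop) : K 0%N -> (forall a b, K a -> K b -> K (a + b)%N) ->
  (forall i, K (omega U_(lshift n i))) ->
  forall a, exists2 c, K c & raises c (fop d a).
Proof.
move=> K0 KD Kl a; have [q <-] := g_surj a.
have X_raises : forall m, exists2 c, K c & raises c (fop d (g 'X_[m])).
  move=> m.
  have up : upward_closed (fun m : 'X_{1..r} => exists2 c, K c & raises c (fop d (g 'X_[m]))).
    apply: upward_by_shift => {}m i [c Kc rc].
    exists (c + omega U_(lshift n i))%N; first exact: KD.
    have -> : fop d (g 'X_[m + U_(i)]) = fop d (g 'X_[m]) * gen_op (lshift n i).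
      by rewrite gen_op_l mpolyXD !rmorphM.
    by apply: raisesM => //; exact: raises_gen.
  apply: (up 0%MM); first by apply/mnm_lepP => i; rewrite mnm0E.
  exists 0%N => //; rewrite mpolyX0 !rmorph1 -[1](rmorph1 (cop d)).
  exact: raises_cop.
elim/mpolyind: q => [|c m q _ _ [c1 K1 rc1]].
  by exists 0%N => //; rewrite !rmorph0 -[0](rmorph0 (cop d)); exact: raises_cop.
have [c2 K2 rc2] := X_raises m; exists (c2 + c1)%N; first exact: KD.
rewrite !rmorphD; apply: raisesD; last by apply: raises_mono rc1; exact: leq_addl.
apply: (@raises_mono (0 + c2)); first by rewrite add0n leq_addr.
rewrite -mul_mpolyC !rmorphM gC; apply: raisesM rc2; exact: raises_cop.
Qed.

Lemma raises_order : (forall i, omega U_(lshift n i) = 0%N) ->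
  (forall j, omega U_(rshift r j) = 1%N) ->
  forall q P, order_filt d q P -> raises q P.
Proof.
move=> wl wr; apply: order_filt_ind => [q a|q j|q P P' _ _|q q' P P' _ _].
- have [||i|c cE rc] := @raises_fop (fun c => c = 0%N) _ _ _ a => //.
    by move=> _ _ -> ->.
  by apply: raises_mono rc; rewrite cE.
- by rewrite -gen_op_r; apply: raises_mono (raises_gen _); rewrite wr.
- exact: raisesB.
- exact: raisesM.
Qed.

Lemma raises_all (P : D) : exists c, raises c P.
Proof.
have [q] := order_exhaustive P.
elim/order_filt_ind => {q P} [_ a|_ j|_ P P' _ _ [c cP] [c' cP']|_ _ P P' _ _ [c cP] [c' cP']].
- by have [|||c _ rc] := @raises_fop (fun _ => True) _ _ _ a => //; exists c.
- by exists (omega U_(rshift r j)); rewrite -gen_op_r; exact: raises_gen.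
- exists (c + c')%N; apply: raisesB; [apply: raises_mono cP|apply: raises_mono cP'].
    exact: leq_addr.
  exact: leq_addl.
- by exists (c + c')%N; apply: raisesM.
Qed.

Hypothesis w_gen : forall u : M, exists c : 'I_(size w) -> D, u = \sum_i c i *: w`_i.

Lemma omega_exhaustive (v : V) : exists t, mspanV (fun y => (omega y.1 <= t)%N) v.
Proof.
have omega0 : omega 0%MM = 0%N.
  by apply: (@addnI (omega 0%MM)); rewrite -omegaD addm0 addn0.
have [c ->] := w_gen v.
elim/big_ind: _ => [|u u' [t tu] [t' tu']|i _].
- by exists 0%N; exact: MspanBase.
- exists (maxn t t'); apply: (mspanD (u := (u : V))).
    by apply: mspan_mono tu => y /leq_trans; apply; exact: leq_maxl.
  by apply: mspan_mono tu' => y /leq_trans; apply; exact: leq_maxr.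
- have [b bP] := raises_all (c i); exists (0 + b)%N; apply: bP.
  by rewrite -basis0; apply: MspanGen; rewrite /= omega0.
Qed.

End Raising.

Hypothesis w_gen : forall u : M, exists c : 'I_(size w) -> D, u = \sum_i c i *: w`_i.

Lemma gen_act_pdeg x y :
  mspanV (fun z => (pdeg p z.1 <= pdeg p (shift y x).1)%N) (gen_act x (monvec y)).
Proof.
have [w0 w0P] := gen_act_shift.
rewrite -[gen_act x _](subrK (monvec (shift y x))); apply: mspanD; last exact: MspanGen.
by apply: mspan_mono (w0P x y) => z [/ltnW].
Qed.

Lemma raises_pdeg q P : F q P -> raises (pdeg p) q P.
Proof.
apply: raises_order.
- exact: pdegD.
- exact: gen_act_pdeg.
- by move=> i; rewrite pdeg1 is_right_l.
- by move=> j; rewrite pdeg1 is_right_r.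
Qed.

(** The order filtration of [M] with the generators [w] placed in degree 0, spanned over [k] and
    zero in negative degrees. *)
Definition piece (j : int) : set M := fun v =>
  if j is Posz t then mspanV (fun y => (pdeg p y.1 <= t)%N) v else v = 0.

Lemma piece0 j : piece j 0.
Proof. by case: j => t //=; exact: MspanBase. Qed.
Lemma pieceB j u v : piece j u -> piece j v -> piece j (u - v).
Proof.
case: j => t /=; last by move=> -> ->; rewrite subrr.
by move=> tu tv; exact: (mspanB (u := (u : V)) (v := (v : V)) tu tv).
Qed.
Lemma pieceS j u : piece j u -> piece (j + 1) u.
Proof.
case: j => t; last by rewrite /= => ->; exact: piece0.
by rewrite -PoszD addn1 /=; apply: mspan_mono => y /leqW.
Qed.
Lemma pieceZ q j a u : F q a -> piece j u -> piece (q%:Z + j) (a *: u).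
Proof.
case: j => t Fa; last by rewrite /= => ->; rewrite scaler0; exact: piece0.
by rewrite -PoszD addnC /=; exact: raises_pdeg.
Qed.

Definition order_mod_filt : mod_filt F M := ModFilt piece0 pieceB pieceS pieceZ.
Local Notation G := order_mod_filt.

Lemma piece_pred t v : G (t%:Z - 1) v -> mspanV (fun y => (pdeg p y.1 < t)%N) v.
Proof.
case: t => [|t]; first by move=> /= ->; exact: MspanBase.
have -> : t.+1%:Z - 1 = t%:Z by lia.
by apply: mspan_mono => y; rewrite ltnS.
Qed.

Lemma lower_piece t v : mspanV (fun y => (pdeg p y.1 < t)%N) v -> G (t%:Z - 1) v.
Proof.
case: t => [|t]; first by elim=> [u ->//|//|c u u' _ -> _ ->]; exact: is0_closed.
have -> : t.+1%:Z - 1 = t%:Z by lia.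
by apply: mspan_mono => y; rewrite ltnS.
Qed.

Lemma piece_basis y : G (pdeg p y.1)%:Z (monvec y).
Proof. by apply: MspanGen. Qed.

(** The finitely many monomials in the vector fields alone, of order at most [t], are the generators
    of a piece over [A]. *)
Lemma pure_right_list t : exists L : seq index,
  (forall x, x \in L -> (pdeg p x.1 <= t)%N) /\
  (forall x, mleft x.1 = 0%MM -> (pdeg p x.1 <= t)%N -> x \in L).
Proof.
have [l [_ lP]] := cone_count 0%MM [set x | p x] t.
exists [seq x <- [seq (m, i) | m <- l, i <- enum 'I_(size w)] | (pdeg p x.1 <= t)%N].
split=> [x|[m i] /= m0 mt]; rewrite mem_filter; first by case/andP.
rewrite mt /=; apply/allpairsP; exists (m, i); rewrite mem_enum; split=> //=.
apply: lP; last by rewrite mdeg_blocks m0 mdeg0 -pdeg_mright.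
split=> [|x]; first by apply/mnm_lepP => x; rewrite mnm0E.
rewrite inE mnm0E; case: (split_ordP x) => [a ->|j ->]; rewrite ?is_right_r //.
by move/(congr1 (fun q : 'X_{1..r} => q a)): m0; rewrite mnmE mnm0E.
Qed.

Lemma piece_coherent j : exists s : seq M, (forall u, u \in s -> G j u) /\
  forall u, G j u -> exists c : 'I_(size s) -> D,
    (forall i, F 0%N (c i)) /\ u = \sum_i c i *: s`_i.
Proof.
case: j => t; last first.
  by exists [::]; split=> // u ->; exists (fun=> 0); rewrite big_ord0; split=> // -[].
have [L [Lt LL]] := pure_right_list t.
exists [seq monvec x : M | x <- L]; split=> [_ /mapP[x xL ->]|u tu].
  by apply: MspanGen; exact: Lt.
pose K : D -> Prop := F 0%N.
have KD a b : K a -> K b -> K (a + b) by exact: rfiltD.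
have KM a b : K a -> K b -> K (a * b) by exact: (@rfiltM _ F 0%N 0%N).
have Kfop a : K (fop d a) by exact: OrdFun.
suff : comb_of K [seq monvec x : M | x <- L] u by [].
elim: tu => [v ->|y yt|c v v' _ IHv _ IHv'].
- by apply: comb_of0; exact: rfilt0.
- pose y' : index := (join_l 0%MM y.1, y.2).
  have -> : (monvec y : M) = fop d (g 'X_[mleft y.1]) *: (monvec y' : M).
    rewrite /monvec /basis_op /y' /= mleft_join mright_join mpolyX0 !rmorph1 mul1r.
    by rewrite scalerA.
  apply: comb_ofZ => //; apply: comb_of_mem.
  + exact: rfilt0.
  + exact: rfilt1.
  apply: map_f; apply: LL; rewrite /= ?mleft_join //.
  by rewrite pdeg_mright mright_join -pdeg_mright.
- exact: (comb_ofD KD (comb_ofZ KM (Kfop c%:A) IHv) IHv').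
Qed.

Lemma cop_order0 c : F 0%N (cop d c).
Proof. exact: OrdFun. Qed.

Local Notation kap := (gr_const cop_order0).

(** The ring [gr F] with its commutativity recorded in the type, as polynomial evaluation and chains
    of primes require. *)
Definition gr_com : comNzRingType :=
  HB.pack (gr F) (GRing.PzSemiRing_hasCommutativeMul.Build (gr F) (gr_order_comm dder dcomm)).

Lemma gen_op_order x : F (p x) (gen_op x).
Proof.
case: (split_ordP x) => [i ->|j ->].
  by rewrite gen_op_l is_right_l; exact: OrdFun.
by rewrite gen_op_r is_right_r; exact: OrdVec.
Qed.

Definition zgen (x : 'I_(r + n)) : gr_com := gcls F (p x) (gen_op x).

(** The correction in [gen_act_shift] has smaller [pdeg], so it vanishes in the associated graded
    module. *)
Lemma zgen_act x y : (zgen x : gr F) *: mcls G (pdeg p y.1)%:Z (monvec y) =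
  mcls G (pdeg p (shift y x).1)%:Z (monvec (shift y x)).
Proof.
rewrite mcls_act; [|exact: gen_op_order|exact: piece_basis].
rewrite -PoszD -pdeg1 -pdegD addmC.
have [w0 w0P] := gen_act_shift.
have low : G ((pdeg p (shift y x).1)%:Z - 1) (gen_act x (monvec y) - monvec (shift y x)).
  by apply: lower_piece; apply: mspan_mono (w0P x y) => z [].
have Gs := piece_basis (shift y x).
have Glow := mfiltS low; rewrite subrK in Glow.
rewrite -[gen_op x *: _]/(gen_act x (monvec y)).
have -> : gen_act x (monvec y) = (gen_act x (monvec y) - monvec (shift y x)) + monvec (shift y x).
  by rewrite subrK.
rewrite [LHS](mclsD Glow Gs) (mcls_eq0 Glow).2 // add0r //.
Qed.

Lemma zmon_act a y : (mmap1 zgen a : gr F) *: mcls G (pdeg p y.1)%:Z (monvec y) =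
  mcls G (pdeg p (a + y.1))%:Z (monvec ((a + y.1)%MM, y.2)).
Proof.
have up : upward_closed (fun a => (mmap1 zgen a : gr F) *: mcls G (pdeg p y.1)%:Z (monvec y) =
    mcls G (pdeg p (a + y.1))%:Z (monvec ((a + y.1)%MM, y.2))).
  apply: upward_by_shift => {}a x IH.
  have -> : (a + U_(x) + y.1 = a + y.1 + U_(x))%MM by rewrite -!addmA [(U_(x) + _)%MM]addmC.
  rewrite mmap1_U -[_ *: _]/(((zgen x : gr F) * (mmap1 zgen a : gr F)) *: _) -scalerA IH.
  exact: (zgen_act x ((a + y.1)%MM, y.2)).
apply: (up 0%MM); first by apply/mnm_lepP => i; rewrite mnm0E.
rewrite mmap11 [LHS]scale1r add0m; by case: (y).
Qed.

(** The class of a monomial vector in its exact degree is a monomial in the symbols applied to the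
    class of some [w_i]; in a higher degree the class is zero. *)
Lemma gr_mod_fin_gen : fin_gen (gr_mod G).
Proof.
pose s : seq (gr_mod G) := [seq mcls G 0 (monvec (0%MM, i)) | i <- enum 'I_(size w)].
have sP u : comb_of (fun _ => True) s u.
  elim/(@mcls_ind _ F M G): u => [|u v su sv|j v Gv]; first exact: comb_of0.
    exact: comb_ofD.
  have mcls0 i : mcls G i 0 = 0.
    by apply/mcls_eq0; exact: mfilt0.
  case: j Gv => t tv; last by rewrite [v]tv mcls0; exact: comb_of0.
  elim: tv => [u ->|y|c u u' tu IHu tu' IHu']; first by rewrite mcls0; exact: comb_of0.
    rewrite leq_eqVlt => /predU1P[<-|yt].
      have := zmon_act y.1 (0%MM, y.2); rewrite /= pdeg0 addm0 -surjective_pairing => <-.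
      apply: comb_ofZ => //; apply: comb_of_mem => //.
      by apply/mapP; exists y.2; rewrite ?mem_enum.
    have low : G (t%:Z - 1) (monvec y) by apply: lower_piece; exact: MspanGen.
    rewrite (mcls_eq0 _).2 //; first exact: comb_of0.
    by rewrite -[t%:Z](subrK 1); exact: mfiltS.
  have Gu : G t%:Z (cop d c *: (u : M)).
    by rewrite -[t%:Z]add0r; apply: mfiltZ => //; exact: cop_order0.
  rewrite -[c *: u]/(cop d c *: (u : M)) [mcls _ _ _](mclsD Gu (tu' : G t%:Z (u' : M))).
  apply: comb_ofD => //; have /= := mcls_act (cop_order0 c) (tu : G t%:Z (u : M)); rewrite add0r => <-.
  exact: comb_ofZ.
exists s => u; have [c [_ ->]] := sP u; by exists c.
Qed.

Lemma order_mod_filt_good : good_filt G.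
Proof.
split.
- move=> u; have [||t ut] := @omega_exhaustive (pdeg p) _ _ w_gen u.
  + exact: pdegD.
  + exact: gen_act_pdeg.
  by exists t%:Z.
- by exists 0 => -[t|t].
- exact: piece_coherent.
- exact: gr_mod_fin_gen.
Qed.

Definition grconst : {rmorphism k -> gr_com} := (kap : {rmorphism k -> gr F}).
Definition symbol_map : {rmorphism {mpoly k[r + n]} -> gr_com} := mmap grconst zgen.

Lemma gcls_lower q (a : D) : F q a -> gcls F q.+1 a = 0.
Proof. by move=> Fa; apply: gcls_eq0. Qed.

Lemma symbol_map_fun a : exists q, symbol_map q = gcls F 0 (fop d a).
Proof.
have F0 (b : A) : F 0%N (fop d b) by exact: OrdFun.
pose Q b := exists q, symbol_map q = gcls F 0 (fop d b).
have QD b c : Q b -> Q c -> Q (b + c).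
  move=> [q1 E1] [q2 E2]; exists (q1 + q2); rewrite rmorphD E1 E2 rmorphD.
  exact (esym (gclsD (F0 b) (F0 c))).
have QM b c : Q b -> Q c -> Q (b * c).
  move=> [q1 E1] [q2 E2]; exists (q1 * q2); rewrite rmorphM E1 E2 rmorphM.
  exact (gclsM (F0 b) (F0 c)).
have QC c : Q (g (mpolyC r c)).
  by exists (mpolyC _ c); rewrite gC; exact: mmapC.
have QX i : Q (g 'X_i).
  exists 'X_(lshift n i); rewrite [LHS]mmapX mmap1U /zgen is_right_l gen_op_l //.
have QXm m : Q (g 'X_[m]).
  have up : upward_closed (fun m => Q (g 'X_[m])).
    by apply: upward_by_shift => {}m i Qm; rewrite mpolyXD rmorphM; exact: QM.
  apply: (up 0%MM); first by apply/mnm_lepP => i; rewrite mnm0E.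
  by rewrite mpolyX0 -mpolyC1.
have [q <-] := g_surj a; elim/mpolyind: q => [|c m q _ _ Qq].
  by rewrite -(mpolyC0 r); exact: QC.
by rewrite rmorphD -mul_mpolyC rmorphM; apply: QD => //; exact: QM.
Qed.

(** It suffices to follow the construction of operators of order [q]; a generator placed in a degree
    above its order has class zero. *)
Lemma symbol_map_surj s : exists q, symbol_map q = s.
Proof.
elim/(@gcls_ind _ F): s => [|a b [q qa] [q' qb]|q a Fqa].
- by exists 0; rewrite rmorph0.
- by exists (q + q'); rewrite rmorphD qa qb.
elim/order_filt_ind: Fqa => {q a} [q a|q j|q P P' qP qP' [a aP] [b bP]|
                                   q q' P P' qP qP' [a aP] [b bP]].
- case: q => [|q]; first exact: symbol_map_fun.
  by exists 0; rewrite rmorph0 gcls_lower //; exact: OrdFun.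
- case: q => [|q].
    by exists 'X_(rshift r j); rewrite [LHS]mmapX mmap1U /zgen is_right_r gen_op_r.
  by exists 0; rewrite rmorph0 gcls_lower //; exact: OrdVec.
- by exists (a - b); rewrite rmorphB aP bP; symmetry; apply: gclsB.
- by exists (a * b); rewrite rmorphM aP bP; apply: gclsM.
Qed.

Lemma symbol_map_generates : generates zgen grconst.
Proof.
move=> Q Qz Q0 Ql s; have [q <-] := symbol_map_surj s.
elim/mpolyind: q => [|c m q _ _ Qq]; first by rewrite rmorph0.
by rewrite rmorphD -mul_mpolyC rmorphM /= mmapC mmapX; apply: Ql.
Qed.

Lemma symbol_map_act (q : {mpoly k[r + n]}) y :
  (symbol_map q : gr F) *: mcls G (pdeg p y.1)%:Z (monvec y) =
  \sum_(a <- msupp q) mcls G (pdeg p (a + y.1))%:Z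
     (cop d q@_a *: (monvec ((a + y.1)%MM, y.2) : M)).
Proof.
rewrite /symbol_map /= /mmap [LHS]scaler_suml; apply: eq_bigr => a _.
rewrite -[_ *: _]/(((grconst q@_a : gr F) * (mmap1 zgen a : gr F)) *: _) -scalerA zmon_act.
by rewrite mcls_act ?add0r //; [exact: cop_order0|exact: (piece_basis ((a + y.1)%MM, y.2))].
Qed.

(** In each degree, a relation gives a combination of standard monomial vectors of one [pdeg] that
    lies in the span of those of smaller [pdeg], so its coefficients vanish. *)
Lemma cone_free (q : {mpoly k[r + n]}) m i :
  (forall a, a \in msupp q -> standard is0 p monvec ((a + m)%MM, i)) ->
  (symbol_map q : gr F) *: mcls G (pdeg p m)%:Z (monvec (m, i)) = 0 -> q = 0.
Proof.
move=> stdq; rewrite (symbol_map_act q (m, i)) /= => sum0.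
apply/mpolyP => a; rewrite mcoeff0; apply/eqP; rewrite mcoeff_eq0; apply/negP => aq.
pose t := pdeg p (a + m).
have low : mspanV (fun y => (pdeg p y.1 < t)%N)
    (\sum_(b <- msupp q | pdeg p (b + m) == t) q@_b *: monvec ((b + m)%MM, i)).
  apply: piece_pred; apply: (mcls_sum_eq0 t%:Z _ sum0) => b _.
  rewrite -[Posz _]add0r; apply: (@mfiltZ _ _ _ G 0%N); first exact: cop_order0.
  exact: (piece_basis ((b + m)%MM, i)).
(* Vectors of [pdeg] equal to [t] that are standard modulo 0 stay standard modulo this lower piece,
   since all its spanning vectors precede them. *)
pose N0' v := mspanV (fun y => (pdeg p y.1 < t)%N) v.
have N0'_0 : N0' 0 by exact: MspanBase.
pose s := [seq ((b + m)%MM, i) | b <- msupp q & pdeg p (b + m) == t].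
have mI b : ((b + m)%MM - m)%MM = b by exact: addmK.
suff H x : x \in s -> q@_(x.1 - m)%MM = 0.
  have : q@_(((a + m)%MM, i).1 - m)%MM = 0 by apply: H; apply: map_f; rewrite mem_filter eqxx.
  by rewrite /= mI => /eqP; rewrite mcoeff_eq0 aq.
move: x; apply: (@standard_independent _ V N0' N0'_0 _ _ p monvec s (fun x => q@_(x.1 - m))).
- by rewrite map_inj_uniq ?filter_uniq ?msupp_uniq // => b b' /(congr1 fst) /=; exact: addIm.
- move=> _ /mapP[b + ->]; rewrite mem_filter => /andP[/eqP bt bq] c c0 cb.
  apply: (stdq b bq c c0); elim: cb => [v lv|y yb|c' v v' _ lv _ lv'].
  + by apply: mspan_mono lv => y yt; left; rewrite /= bt.
  + exact: MspanGen.
  + exact: MspanLin.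
- by rewrite /s big_map big_filter; under eq_bigr do rewrite /= mI.
Qed.

Lemma gen_act0 x v : v = 0 -> gen_act x v = 0.
Proof. by move=> ->; rewrite /gen_act [LHS]scaler0. Qed.

(** * Growth of holonomic modules *)

Section Holonomic.
Variable e : nat.
Hypotheses (char0 : forall n, n.+1%:R != 0 :> k) (dim_car : dim_le (Car F M) e).

(** On a cone of standard monomials, the polynomials in the [e + 1] variables of [J] act freely on
    the class [u] of its vertex. Then [prime_chain] yields [e + 2] primes containing the annihilator
    of [u], one more than the dimension allows. *)
Lemma no_large_cone m (J : {set 'I_(r + n)}) i : #|J| = e.+1 ->
  ~ (forall m', in_cone m J m' -> standard is0 p monvec (m', i)).
Proof.
move=> cJ stdJ; have [x0 _] : exists x, x \in J by apply/card_gt0P; rewrite cJ.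
pose j a := nth x0 (enum J) a.
have sizeJ : size (enum J) = e.+1 by rewrite -cardE.
have [|eta [etaC eta_inj eta_supp]] := @tower_embedding k (r + n) j e.+1.
  move=> a b ae be /eqP; rewrite nth_uniq ?sizeJ ?enum_uniq // => /eqP.
  by [].
pose u := mcls G (pdeg p m)%:Z (monvec (m, i)).
pose I (a : gr_com) := (a : gr F) *: u = 0.
have [||a Ia|P [Pspec Pinc]] :=
    @prime_chain k gr_com _ zgen char0 e.+1 (symbol_map \o eta) I.
- have -> : (fun c => (symbol_map \o eta) (tower_const e.+1 c)) = grconst.
    by apply: funext => c; rewrite [LHS]/= etaC; exact: mmapC.
  exact: symbol_map_generates.
- split=> [|a b c Ib Ic]; first exact: scale0r.
  by rewrite /I -[_ *: _]/(((a : gr F) * (b : gr F) + c) *: u) scalerDl -scalerA [b *: u]Ib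
    [c *: u]Ic scaler0 addr0.
- apply: eta_inj; apply: cone_free Ia => b bs; apply: stdJ; split; first exact: lem_addl.
  move=> x xJ; rewrite mnmDE (eta_supp _ _ _ bs) // => t te.
  by apply: contra xJ => /eqP <-; rewrite -mem_enum mem_nth ?sizeJ.
have := dim_car (l := e.+1) (P := P); rewrite ltnn => H.
suff: false by [].
apply: H => // a ae; have [sP IP] := Pspec a ae.
exists G; split; first exact: order_mod_filt_good.
by split=> //; exists u => b bu; apply: IP.
Qed.

Lemma standard_growth : exists C, forall s, exists l : seq index,
  (size l <= C * s.+1 ^ e)%N /\
  forall x, standard is0 p monvec x -> (mdeg x.1 <= s)%N -> x \in l.
Proof.
have [w0 w0P] := gen_act_shift.
have /choice[C CP] : forall i : 'I_(size w), exists C, forall s,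
    exists l : seq 'X_{1..r + n}, (size l <= C * s.+1 ^ e)%N /\
      forall m, standard is0 p monvec (m, i) -> (mdeg m <= s)%N -> m \in l.
  move=> i.
  have [[C CP]|[m [J [cJ Jstd]]]] := complement_growth e
      (nonstandard_upward (i := i) (erefl 0) gen_act_linear gen_act0 w0P).
    exists C => s; have [l [sl lP]] := CP s; exists l; split=> // m stdm.
    by apply: lP; exact.
  case: (@no_large_cone m J i cJ) => m' /Jstd; exact: contrapT.
exists (\sum_i C i)%N => s.
suff [l [sl lP]] : exists l : seq index, (size l <= (\sum_(i <- enum 'I_(size w)) C i) * s.+1 ^ e)%N /\
    forall x, x.2 \in enum 'I_(size w) -> standard is0 p monvec x -> (mdeg x.1 <= s)%N -> x \in l.
  exists l; split; first by move: sl; rewrite big_enum.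
  by move=> x; apply: lP; rewrite mem_enum.
elim: (enum _) => [|i t [l [sl lP]]]; first by exists [::].
have [l' [sl' lP']] := CP i s; exists ([seq (m, i) | m <- l'] ++ l).
rewrite size_cat size_map big_cons mulnDl leq_add //; split=> // -[m i'] /=.
rewrite inE mem_cat => /predU1P[->|i't] stdm ms; last by rewrite lP ?orbT.
by rewrite map_f // lP'.
Qed.

(** Every monomial vector of weight at most [s] reduces to standard ones of degree [O(s)], whose
    number is bounded by [standard_growth]; the multiplier [B ^+ t] is invertible over the field
    [k]. *)
Lemma holonomic_growth w0 :
  (forall x y, mspanV (fun z => (pdeg p z.1 < pdeg p (shift y x).1)%N /\
                   (weight p w0 z.1 <= weight p w0 (shift y x).1)%N)
         (gen_act x (monvec y) - monvec (shift y x))) ->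
  exists C, forall s, exists l : seq V, (size l <= C * s.+1 ^ e)%N /\
    forall v, mspanV (fun y => (weight p w0 y.1 <= s)%N) v ->
      exists c : 'I_(size l) -> k, v = \sum_i c i *: l`_i.
Proof.
move=> w0P; have [C CP] := standard_growth.
have [w1 [B [B0 red]]] := standard_reduction (erefl 0) gen_act_linear gen_act0 w0P.
(* Reduction preserves the bound on [weight p w1], which is at most [w1.+1] times the total degree;
   hence the standard monomials that occur have degree at most [w1.+1 * s]. *)
exists (C * w1.+1 ^ e)%N => s; have [l [sl lP]] := CP (w1.+1 * s)%N.
exists (map monvec l); split.
  rewrite size_map -mulnA -expnMn; apply: leq_trans sl _.
  rewrite leq_mul2l; apply/orP; right.
  have expn_le a b : (a <= b)%N -> (a ^ e <= b ^ e)%N.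
    by case: (e) => // e' ab; rewrite leq_exp2r.
  by apply: expn_le; nia.
pose T := fun _ : k => True.
move=> v vs; suff [c [_ vE]] : comb_of T (map monvec l) v by exists c.
elim: vs => [u ->|y ys|c u u' _ IHu _ IHu']; first exact: comb_of0.
- have [t tB] := red y.
  suff : comb_of T (map monvec l) (B ^+ t *: monvec y).
    move/(@comb_ofZ _ _ T (fun _ _ _ _ => Logic.I) _ (B ^+ t)^-1 _ Logic.I).
    by rewrite scalerA mulVf ?expf_neq0 // scale1r.
  elim: tB => [u ->|z [stdz zy]|c u u' _ IHu _ IHu']; first exact: comb_of0.
    apply: comb_of_mem => //; apply: map_f; apply: lP => //.
    have ym : (mdeg y.1 <= s)%N by apply: leq_trans ys; rewrite /weight leq_addr.
    have zy' : (mdeg z.1 <= weight p w1 y.1)%N.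
      by apply: leq_trans zy; rewrite /weight leq_addr.
    apply: leq_trans zy' _; rewrite /weight.
    by have := pdeg_le_mdeg p y.1; nia.
  by apply: comb_ofD => //; apply: comb_ofZ.
- by apply: comb_ofD => //; apply: comb_ofZ.
Qed.

End Holonomic.

End Module.

(** * Dual numbers and the commutation of the coordinate vector fields *)

Section DualNumbers.
Variable A : comNzRingType.

(** The dual numbers over [A]: the pair [(a, b)] stands for [a + b eps] with [eps ^ 2 = 0]. *)
Definition dual : Type := (A * A)%type.
HB.instance Definition _ := GRing.Zmodule.on dual.

Definition dual_one : dual := (1, 0).
Definition dual_mul (x y : dual) : dual := (x.1 * y.1, x.1 * y.2 + x.2 * y.1).

Fact dual_mulA : associative dual_mul.
Proof.
move=> x y z; rewrite /dual_mul /=; congr (_, _); first exact: mulrA.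
by rewrite mulrDr mulrDl !mulrA addrA.
Qed.
Fact dual_mulC : commutative dual_mul.
Proof.
move=> x y; rewrite /dual_mul; congr (_, _); first exact: mulrC.
by rewrite addrC mulrC [x.1 * _]mulrC.
Qed.
Fact dual_mul1 : left_id dual_one dual_mul.
Proof. by case=> a b; rewrite /dual_mul /= !mul1r mul0r addr0. Qed.
Fact dual_mulDl : left_distributive dual_mul +%R.
Proof.
move=> x y z; rewrite /dual_mul /=; congr (_, _); first exact: mulrDl.
by rewrite !mulrDl addrACA.
Qed.
HB.instance Definition _ := GRing.Zmodule_isComPzRing.Build dual
  dual_mulA dual_mulC dual_mul1 dual_mulDl.

Variable delta : A -> A.
Hypotheses (deltaB : zmod_morphism delta)
  (deltaM : forall a b, delta (a * b) = a * delta b + delta a * b).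

(* The proof arguments are there for the inference of the morphism instances. *)
Definition dual_section & zmod_morphism delta
  & (forall a b, delta (a * b) = a * delta b + delta a * b) :=
  fun a : A => (a, delta a) : dual.
Local Notation ds := (dual_section deltaB deltaM).
Fact dual_section_zmod_morphism : zmod_morphism ds.
Proof. by move=> a b; rewrite /dual_section deltaB. Qed.
Fact dual_section_monoid_morphism : monoid_morphism ds.
Proof.
split=> [|a b]; rewrite /dual_section; last by rewrite deltaM.
congr (_, _); have := deltaM 1 1; rewrite !mulr1 mul1r => /eqP.
by rewrite -subr_eq0 opprD addrA subrr sub0r oppr_eq0 => /eqP.
Qed.
HB.instance Definition _ :=
  GRing.isZmodMorphism.Build A dual ds dual_section_zmod_morphism.
HB.instance Definition _ :=
  GRing.isMonoidMorphism.Build A dual ds dual_section_monoid_morphism.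

Definition dual_fst (x : dual) : A := x.1.
Fact dual_fst_zmod_morphism : zmod_morphism dual_fst. Proof. by []. Qed.
Fact dual_fst_monoid_morphism : monoid_morphism dual_fst. Proof. by []. Qed.
HB.instance Definition _ :=
  GRing.isZmodMorphism.Build dual A dual_fst dual_fst_zmod_morphism.
HB.instance Definition _ :=
  GRing.isMonoidMorphism.Build dual A dual_fst dual_fst_monoid_morphism.

End DualNumbers.

(** Both [a] and [a + delta(a) eps] define lifts of the identity of [A] to the dual numbers, and
    they agree on [R]; by unramifiedness they coincide. *)
Lemma unramified_derivation0 (R A : comNzRingType) (f : {rmorphism R -> A}) (delta : A -> A) :
  formally_unramified f -> zmod_morphism delta ->
  (forall a b, delta (a * b) = a * delta b + delta a * b) ->
  (forall r, delta (f r) = 0) -> forall a, delta a = 0.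
Proof.
move=> unr dB dM df a.
have zB : zmod_morphism (fun _ : A => 0 : A) by move=> x y; rewrite subrr.
have zM (x y : A) : 0 = x * 0 + 0 * y :> A by rewrite mulr0 mul0r addr0.
pose h1 : {rmorphism A -> dual A} := dual_section zB zM.
pose h2 : {rmorphism A -> dual A} := dual_section dB dM.
pose pi : {rmorphism dual A -> A} := @dual_fst A.
suff /(_ a)/(congr1 snd) : h1 =1 h2 by move=> /esym.
apply: (unr (dual A) A pi (h1 \o f) idfun h1 h2) => //.
- split=> [c|x y]; first by exists (c, 0).
  case: x y => [x1 x2] [y1 y2]; rewrite /pi /= /dual_fst /= => -> ->.
  by congr (_, _); rewrite /= ?mul0r ?mulr0 ?addr0.
- by split=> // r; rewrite /= /dual_section df.
Qed.

(** The commutator of two coordinate fields is a derivation. It kills the coordinates, whose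
    derivatives are the constants 0 and 1, hence all polynomials in them, and therefore vanishes on
    [A]. *)
Lemma coord_vector_fields_commute (k : fieldType) n (A : comAlgType k)
    (f : {lrmorphism {mpoly k[n]} -> A}) (d : 'I_n -> kend A) :
  formally_unramified f -> coord_vector_fields f d ->
  forall i j a, d i (d j a) = d j (d i a).
Proof.
move=> unr [dder dX] i j a; apply/eqP; rewrite -subr_eq0; apply/eqP.
have d0 (P : kend A) : P 0 = 0.
  by have := kendP P (-1) 0 0; rewrite scaler0 addr0 scaleN1r addNr.
have dD (P : kend A) x y : P (x + y) = P x + P y.
  by have := kendP P 1 x y; rewrite !scale1r.
have dZ (P : kend A) c x : P (c *: x) = c *: P x.
  by have := kendP P c x 0; rewrite d0 !addr0.
have dB (P : kend A) x y : P (x - y) = P x - P y.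
  by rewrite dD -scaleN1r dZ scaleN1r.
pose delta x := d i (d j x) - d j (d i x).
have deltaM x y : delta (x * y) = x * delta y + delta x * y.
  rewrite /delta !dder !dD !dder mulrBr mulrBl.
  have cancel (a1 a2 b c e1 e2 : A) :
    a1 + b + (c + e1) - (a2 + c + (b + e2)) = a1 - a2 + (e1 - e2).
    have -> : a1 + b + (c + e1) = (a1 + e1) + (b + c) by rewrite [c + e1]addrC addrACA.
    have -> : a2 + c + (b + e2) = (a2 + e2) + (b + c).
      by rewrite [b + e2]addrC addrACA [c + b]addrC.
    by rewrite opprD addrACA subrr addr0 opprD addrACA.
  exact: cancel.
have delta1 c : delta c%:A = 0.
  have d1 l : d l 1 = 0 by apply: derivation1.
  by rewrite /delta !dZ !d1 !d0 scaler0 subrr.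
have deltaf q : delta (f q) = 0.
  have deltaD x y : delta (x + y) = delta x + delta y.
    by rewrite /delta !dD opprD addrACA.
  have fX m : delta (f 'X_[m]) = 0.
    have up : upward_closed (fun m => delta (f 'X_[m]) = 0).
      apply: upward_by_shift => {}m l mE; rewrite mpolyXD rmorphM deltaM mE mul0r addr0.
      have -> : delta (f 'X_l) = 0; last by rewrite mulr0.
      rewrite /delta -/(Defs.coord f l) !dX.
      have dn t (b : bool) : d t b%:R = 0 :> A.
        by case: b; [apply: derivation1|apply: d0].
      by rewrite !dn subrr.
    apply: (up 0%MM); first by apply/mnm_lepP => l; rewrite mnm0E.
    by rewrite mpolyX0 rmorph1 -[1]scale1r delta1.
  elim/mpolyind: q => [|c m q _ _ IH]; first by rewrite rmorph0 /delta !d0 subrr.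
  have fZ x : f (c *: x) = c *: f x by exact: linearZ.
  have fD x y : f (x + y) = f x + f y by exact: rmorphD.
  by rewrite fD deltaD IH addr0 fZ /delta !dZ -scalerBr -/(delta _) fX scaler0.
apply: (unramified_derivation0 unr (delta := delta)) => // x y.
by rewrite /delta !dB !opprD !opprK addrACA.
Qed.

(** * Passage to the logarithmic operators *)

Section RestrictedLinearMap.
Variables (k : fieldType) (R R' : nzRingType) (phi : {rmorphism R' -> R}).
Variables (kappa : {rmorphism k -> R}) (M : lmodType R) (N : lmodType R').
Variable iota : {linear N -> restr phi M}.

(** The same map with target [M] regarded as a vector space over [k], where growth is measured. *)
Definition underlying_map (v : N) : restr kappa M := (iota v : M).
Fact underlying_zmod_morphism : zmod_morphism underlying_map.
Proof. by move=> u v; rewrite /underlying_map raddfB. Qed.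
HB.instance Definition _ :=
  GRing.isZmodMorphism.Build N (restr kappa M) underlying_map underlying_zmod_morphism.

End RestrictedLinearMap.

(* X = Spec A, and f : k[x_1, ..., x_n] -> A is the comorphism of p : X -> A^n.  *)
Theorem theorem2p3p1 (k : fieldType) (char0 : [pchar k] =i pred0)
    (m n : nat) (le_mn : (m <= n)%N)
    (A : comAlgType k) (smoothA : smooth (GRing.in_alg A))
    (f : {lrmorphism {mpoly k[n]} -> A}) (etale_f : etale f)
    (d : 'I_n -> kend A) (dP : coord_vector_fields f d)
    (M : lmodType (diff_ring d)) (holM : holonomic M) :
  log_holonomic (restr (log_incl f m d) M).
Proof.
have [[r [g [_ [gC g_surj _]]]] _] := smoothA.
have [_ _ unr] := etale_f.
have [w w_gen] := holM.1; have [dder _] := dP.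
have dcomm := coord_vector_fields_commute unr dP.
have [w0 w0P] := gen_act_shift dder dcomm gC g_surj w.
have [C growth] := holonomic_growth dder dcomm gC g_surj w_gen
  (fun j => char0_natr char0 j) holM.2 w0P.
move=> M0 iota iota_inj _ l P carP incP.
(* [G] is the good filtration attached to the smallest prime [P 0]; its support condition gives a
   vector of [gr M0] with annihilator in [P 0]. *)
have [G [_ suppP]] := carP 0%N (leq0n l).
pose h : {additive M0 -> restr (cop d) M} := @underlying_map _ _ _ _ (cop d) M M0 iota.
pose omega := weight (is_right (r := r) (n := n)) w0.
have omegaD := weightD (is_right (r := r) (n := n)) w0.
have gen_omega x y : mspan (fun v : restr (cop d) M => v = 0) (monvec g (w:=w))
    (fun z => (omega z.1 <= omega (shift y x).1)%N) (gen_act g x (monvec g (w:=w) y)).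
  rewrite -[gen_act g x _](subrK (monvec g (w:=w) (shift y x))).
  apply: mspanD; last exact: MspanGen.
  by apply: mspan_mono (w0P x y) => z [].
(* The growth filtration of [M]: by [growth], [W s] is spanned by at most [C * s.+1 ^ n] vectors. *)
pose W s (v : restr (cop d) M) := mspan (fun v : restr (cop d) M => v = 0) (monvec g (w:=w))
  (fun y => (omega y.1 <= s)%N) v.
apply: (@chain_length_le_growth k _ _ (cop (log_vector_fields f m d)) _ M0 G
  (restr (cop d) M) h _ _ W C n _ _ _ growth _ _ l P) => //.
- by move=> c; exact: OrdFun.
- move=> c v; rewrite /h /= /underlying_map linearZ.
  change (log_incl f m d (cop (log_vector_fields f m d) c) *: (iota v : M) =
          cop d c *: (iota v : M)).
  by congr (_ *: _); apply: val_inj.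
- by move=> s t u st; apply: mspan_mono => y /leq_trans; apply.
- by move=> s; exact: MspanBase.
- by move=> s u v; exact: mspanD.
- move=> v; exact: (omega_exhaustive gC g_surj omegaD gen_omega w_gen).
(* A logarithmic operator acts through its image in the full ring of operators, so it raises the
   weight by a bounded amount. *)
- move=> a; have [c ac] := raises_all gC g_surj omegaD gen_omega (log_incl f m d a).
  exists c => t v Wv; have := ac t _ Wv.
  by rewrite /h /= /underlying_map linearZ.
- by move=> i il; have [G' [_ []]] := carP i il.
Qed.
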